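(* Let $n,m,k$ be positive integers, let $X\in\mathbb{C}^{n\times n}$ be Hermitian, let $\Lambda:\mathbb{C}^{n\times n}\to\mathbb{C}^{m\times m}$ be a linear map and $Y\in\mathbb{C}^{m\times m}$. Let $\xi$ be the optimal value of \[ \max_{\rho\in\mathbb{C}^{n\times n}}\ \operatorname{Tr}(X\rho)\quad\text{s.t.}\quad \Lambda(\rho)=Y,\ \operatorname{Tr}(\rho)=1,\ \rho\ge 0,\ \operatorname{rank}(\rho)\le k . \] For a positive integer $N$, let $\mathcal{H}_A=\mathcal{H}_B=\cdots=\mathcal{H}_Z=\mathbb{C}^n\otimes\mathbb{C}^k$ be $N$ copies (parties $A,B,\dots,Z$), let $\widetilde{X}=X\otimes\mathbb{1}_k$, $\widetilde{\Lambda}(\cdot)=\Lambda[\operatorname{Tr}_2(\cdot)]$ with $\operatorname{Tr}_2$ the partial trace over $\mathbb{C}^k$, and let $\xi_N$ be the optimal value of the semidefinite program \[ \max_{\Phi_{AB\cdots Z}}\ \operatorname{Tr}\big[(\widetilde{X}_A\otimes\mathbb{1}_{B\cdots Z})\Phi_{AB\cdots Z}\big]\quad\text{s.t.}\quad \Phi_{AB\cdots Z}\ge0,\ \operatorname{Tr}(\Phi_{AB\cdots Z})=1,\ P_N^+\Phi_{AB\cdots Z}P_N^+=\Phi_{AB\cdots Z}, \] \[ (\widetilde{\Lambda}_A\otimes\mathrm{id}_{B\cdots Z})(\Phi_{AB\cdots Z})=Y\otimes\operatorname{Tr}_A(\Phi_{AB\cdots Z}). \] Then $\xi\le\xi_N$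 for every $N$, and moreover $\xi_{N+1}\le\xi_N$ for all $N$ and $\lim_{N\to+\infty}\xi_N=\xi$.
   Context: $\Phi_{AB\cdots Z}$ ranges over complex Hermitian operators on $\mathcal{H}_A\otimes\cdots\otimes\mathcal{H}_Z=(\mathbb{C}^n\otimes\mathbb{C}^k)^{\otimes N}$. $P_N^+=\frac{1}{N!}\sum_{\sigma\in S_N}V_\sigma$ is the orthogonal projector onto the symmetric subspace of $(\mathbb{C}^n\otimes\mathbb{C}^k)^{\otimes N}$, where $V_\sigma$ permutes the $N$ tensor factors according to $\sigma\in S_N$. A subscript $A$ indicates action on the first party; $\mathrm{id}_{B\cdots Z}$ is the identity map on operators of the remaining $N-1$ parties; $\operatorname{Tr}_A$ is the partial trace over the first party. *)

(* Defs.v *)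
From HB Require Import structures.
From mathcomp Require Import all_boot all_order all_algebra all_fingroup.
From mathcomp Require Import complex.
From mathcomp Require Import all_classical all_reals all_analysis.
Set Implicit Arguments. Unset Strict Implicit. Unset Printing Implicit Defensive.
Import Order.TTheory GRing.Theory Num.Theory.
Local Open Scope ring_scope.
Local Open Scope complex_scope.

Section Defs.
Variable R : realType.
Local Notation C := R[i].

Definition ctrmx (p q : nat) (A : 'M[C]_(p, q)) : 'M[C]_(q, p) := map_mx Num.conj A^T.

Definition herm (d : nat) (A : 'M[C]_d) : Prop := ctrmx A = A.

Definition psd (d : nat) (A : 'M[C]_d) : Prop :=
  herm A /\ forall v : 'cV[C]_d, 0 <= (ctrmx v *m A *m v) 0 0.

(* Operators on C^T for a finite index type T are #|T| x #|T| matrices,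
   indexed through enum_rank. *)
Definition opm (T : finType) (f : T -> T -> C) : 'M[C]_#|T| :=
  \matrix_(i, j) f (enum_val i) (enum_val j).
Definition ope (T : finType) (A : 'M[C]_#|T|) (x y : T) : C :=
  A (enum_rank x) (enum_rank y).

Definition feasible (n m k : nat) (Lam : {linear 'M[C]_n -> 'M[C]_m})
  (Y : 'M[C]_m) (rho : 'M[C]_n) : Prop :=
  [/\ Lam rho = Y, \tr rho = 1, psd rho & (\rank rho <= k)%N].

(* xi : the optimal value (supremum; -oo if infeasible) *)
Definition xi (n m k : nat) (X : 'M[C]_n) (Lam : {linear 'M[C]_n -> 'M[C]_m})
  (Y : 'M[C]_m) : \bar R :=
  ereal_sup [set ((complex.Re (\tr (X *m rho)))%:E) | rho in @feasible n m k Lam Y].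

(* single party H = C^n (x) C^k, basis indexed by 'I_n * 'I_k *)
Notation party n k := ('I_n * 'I_k)%type.

(* N.+1 parties A,B,...: basis of H^(x)(N+1) indexed by ffun 'I_N.+1 -> party;
   party A is ord0, the remaining parties B..Z are indexed by 'I_N. *)
Notation allP n k N := {ffun 'I_N.+1 -> party n k}.
Notation restP n k N := {ffun 'I_N -> party n k}.

Definition pcons (n k N : nat) (s : party n k) (y : restP n k N) : allP n k N :=
  [ffun i : 'I_N.+1 => if unlift ord0 i is Some j then y j else s].

Definition Xt (n k : nat) (X : 'M[C]_n) : 'M[C]_#|{: party n k}| :=
  opm (fun s s' : party n k => X s.1 s'.1 * (s.2 == s'.2)%:R).

Definition tr2 (n k : nat) (M : 'M[C]_#|{: party n k}|) : 'M[C]_n :=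
  \matrix_(a, a') \sum_(b : 'I_k) ope M (a, b) (a', b).

Definition Lamt (n m k : nat) (Lam : {linear 'M[C]_n -> 'M[C]_m})
  (M : 'M[C]_#|{: party n k}|) : 'M[C]_m := Lam (tr2 M).

Definition XA (n k N : nat) (X : 'M[C]_n) : 'M[C]_#|{: allP n k N}| :=
  opm (fun x x' : allP n k N =>
    ope (Xt k X) (x ord0) (x' ord0) *
    [forall j : 'I_N, x (lift ord0 j) == x' (lift ord0 j)]%:R).

Definition trA (n k N : nat) (Phi : 'M[C]_#|{: allP n k N}|) : 'M[C]_#|{: restP n k N}| :=
  opm (fun y y' : restP n k N =>
    \sum_(s : party n k) ope Phi (pcons s y) (pcons s y')).

Definition LamA (n m k N : nat) (Lam : {linear 'M[C]_n -> 'M[C]_m})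
  (Phi : 'M[C]_#|{: allP n k N}|) : 'M[C]_#|{: 'I_m * restP n k N}| :=
  opm (fun (iy iy' : ('I_m * restP n k N)%type) =>
    Lamt Lam (opm (fun s s' : party n k => ope Phi (pcons s iy.2) (pcons s' iy'.2)))
      iy.1 iy'.1).

Definition kronY (m : nat) (T : finType) (Y : 'M[C]_m) (M : 'M[C]_#|T|) :
  'M[C]_#|{: 'I_m * T}| :=
  opm (fun (iy iy' : ('I_m * T)%type) => Y iy.1 iy'.1 * ope M iy.2 iy'.2).

Definition Vperm (n k N : nat) (s : 'S_N.+1) : 'M[C]_#|{: allP n k N}| :=
  opm (fun x y : allP n k N => (x == [ffun i => y (s i)])%:R).
Definition Psym (n k N : nat) : 'M[C]_#|{: allP n k N}| :=
  (N.+1)`!%:R^-1 *: \sum_(s : 'S_N.+1) Vperm n k s.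

Definition sdp_feasible (n m k N : nat) (Lam : {linear 'M[C]_n -> 'M[C]_m})
  (Y : 'M[C]_m) (Phi : 'M[C]_#|{: allP n k N}|) : Prop :=
  [/\ psd Phi, \tr Phi = 1, Psym n k N *m Phi *m Psym n k N = Phi
    & LamA Lam Phi = kronY Y (trA Phi)].

(* xi_hier N = xi_{N+1}, the value of the SDP with N+1 parties *)
Definition xi_hier (n m k : nat) (X : 'M[C]_n) (Lam : {linear 'M[C]_n -> 'M[C]_m})
  (Y : 'M[C]_m) (N : nat) : \bar R :=
  ereal_sup [set ((complex.Re (\tr (@XA n k N X *m Phi)))%:E)
            | Phi in @sdp_feasible n m k N Lam Y].

End Defs.

(* Main.v *)
Require Import Defs.
From HB Require Import structures.
From mathcomp Require Import all_boot all_order all_algebra all_fingroup.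
From mathcomp Require Import complex.
From mathcomp Require Import all_classical all_reals all_analysis.
From mathcomp Require Import ring lra.
Import Order.TTheory GRing.Theory Num.Theory.
Set Implicit Arguments. Unset Strict Implicit. Unset Printing Implicit Defensive.
Local Open Scope ring_scope.
Local Open Scope classical_set_scope.

(** A conditioning proof of the bosonic quantum de Finetti theorem, without
    integration.  Contract one party of a symmetric [f] with each vector of the
    tight frame [pvec]; this preserves all constraints, which are homogeneous,
    and writes [f]'s first marginal [rho] as a mixture of the marginals [r b] of
    the contracted operators.  The purity [tr (rho^2) / tr rho] is a bounded
    submartingale along such contractions.  When its mean increment is small the
    first party is almost independent of the contracted one; as swapping the two
    acts trivially, the first marginal is then almost pure.  Hence after [N]
    contractions every conditional state [s], once normalised, satisfies
    [Lam (tr2 s) = Y] exactly, and their mean defect of purity is at most [e]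
    plus a term [O(1/(e N))], for every [e > 0].  By compactness the
    objective of such a state exceeds any [t > xi] by at most a constant times
    its defect of purity, because a pure state has a feasible partial trace.
    Conversely a feasible [rho = B B^*] is the partial trace of the pure state
    with amplitudes [B], whose tensor powers are feasible at every level. *)

(** * Sesquilinear forms and positive semidefinite kernels on a finite type *)

Section Forms.
Variables (R : realType) (T : finType).
Local Notation C := R[i].
Implicit Types (f g : T -> T -> C) (u v w : T -> C).

Definition form f w v : C := \sum_x \sum_y (w x)^* * f x y * v y.

Definition fherm f := forall x y, (f y x)^* = f x y.

Definition fpsd f := fherm f /\ forall v, 0 <= form f v v.

Definition dirac_vec (x : T) : T -> C := fun y => (y == x)%:R.

Lemma sum_mul_dirac (a : T -> C) x : \sum_y a y * dirac_vec x y = a x.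
Proof.
rewrite (bigD1 x) //= /dirac_vec eqxx mulr1 big1 ?addr0 // => y /negbTE ->.
by rewrite mulr0.
Qed.

Lemma formDr f w a v b v' :
  form f w (fun z => a * v z + b * v' z) = a * form f w v + b * form f w v'.
Proof.
rewrite /form !mulr_sumr -big_split; apply: eq_bigr => x _ /=.
rewrite !mulr_sumr -big_split; apply: eq_bigr => y _ /=; ring.
Qed.

Lemma form_conj f w v : fherm f -> (form f w v)^* = form f v w.
Proof.
move=> hf; rewrite /form rmorph_sum exchange_big /=.
rewrite exchange_big /=; under eq_bigr => x _ do rewrite rmorph_sum /=.
rewrite exchange_big /=; apply: eq_bigr => x _; apply: eq_bigr => y _.
by rewrite !rmorphM /= conjCK hf; ring.
Qed.

Lemma formDl f w a v b v' :
  form f (fun z => a * v z + b * v' z) w = a^* * form f v w + b^* * form f v' w.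
Proof.
rewrite /form !mulr_sumr -big_split; apply: eq_bigr => x _ /=.
rewrite !mulr_sumr -big_split; apply: eq_bigr => y _ /=.
by rewrite rmorphD !rmorphM /=; ring.
Qed.

Lemma form_dirac f x y : form f (dirac_vec x) (dirac_vec y) = f x y.
Proof.
rewrite /form -[RHS]mulr1; under eq_bigr => z _ do rewrite sum_mul_dirac.
under eq_bigr => z _ do rewrite mulrC.
rewrite -[RHS](sum_mul_dirac (fun z => f z y * 1)); apply: eq_bigr => z _.
by rewrite mulr1 /dirac_vec rmorph_nat.
Qed.

(* [0 <= q(c w - B(v,w) v) = c (c q(w) - |B(v,w)|^2)] with [c = q(v)]; when
   [q(v)] and [q(w)] both vanish, use [w - B(v,w) v] instead. *)
Lemma fpsd_cauchy_schwarz f w v : fpsd f ->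
  form f w v * form f v w <= form f w w * form f v v.
Proof.
move=> [hf pf].
have H a b w1 v1 : 0 <= a * a^* * form f w1 w1 + b * b^* * form f v1 v1
       + a^* * b * form f w1 v1 + a * b^* * form f v1 w1.
  have := pf (fun z => a * w1 z + b * v1 z).
  by rewrite formDl !formDr; congr (0 <= _); ring.
have key w1 v1 : 0 < form f v1 v1 ->
    form f w1 v1 * form f v1 w1 <= form f w1 w1 * form f v1 v1.
  move=> c0; have := H (form f v1 v1) (- form f v1 w1) w1 v1.
  rewrite rmorphN /= !form_conj// => {}H.
  rewrite -subr_ge0 -(pmulr_rge0 _ c0).
  by move: H; congr (0 <= _); ring.
have := pf v; rewrite le_eqVlt => /orP[/eqP v0|/key//].
have := pf w; rewrite le_eqVlt => /orP[/eqP w0|/key]; last first.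
  by rewrite mulrC [X in _ <= X]mulrC.
have := H 1 (- form f v w) w v.
rewrite -v0 -w0 !mulr0 !add0r rmorphN rmorph1 /= form_conj//.
have -> : 1 * - form f v w * form f w v + 1 * - form f w v * form f v w =
  - ((form f w v * form f v w) *+ 2) by ring.
by rewrite oppr_ge0 pmulrn_lle0.
Qed.

Lemma fpsd_diag_ge0 f x : fpsd f -> 0 <= f x x.
Proof. by move=> [_ /(_ (dirac_vec x))]; rewrite form_dirac. Qed.

Lemma fpsd_entry f x y : fpsd f -> f x y * f y x <= f x x * f y y.
Proof.
by move=> /(@fpsd_cauchy_schwarz _ (dirac_vec x) (dirac_vec y)); rewrite !form_dirac.
Qed.

Definition mulfv f v x : C := \sum_y f x y * v y.

Lemma form_mulfv f w v : form f w v = \sum_x (w x)^* * mulfv f v x.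
Proof.
apply: eq_bigr => x _; rewrite mulr_sumr; apply: eq_bigr => y _.
by rewrite mulrA.
Qed.

Lemma form_rank1 u w v :
  form (fun x y => u x * (u y)^*) w v = (\sum_x (w x)^* * u x) * \sum_y (u y)^* * v y.
Proof.
rewrite /form big_distrl; apply: eq_bigr => x _ /=.
by rewrite mulr_sumr; apply: eq_bigr => y _; rewrite !mulrA.
Qed.

Lemma form_lin f g a b w v :
  form (fun x y => a * f x y + b * g x y) w v = a * form f w v + b * form g w v.
Proof.
rewrite /form !mulr_sumr -big_split; apply: eq_bigr => x _ /=.
rewrite !mulr_sumr -big_split; apply: eq_bigr => y _ /=; ring.
Qed.

Lemma fpsd_rank1 u : fpsd (fun x y => u x * (u y)^*).
Proof.
split=> [x y|v]; first by rewrite rmorphM /= conjCK mulrC.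
rewrite form_rank1.
have -> : \sum_y (u y)^* * v y = (\sum_x (v x)^* * u x)^*.
  by rewrite rmorph_sum; apply: eq_bigr => x _; rewrite rmorphM /= conjCK mulrC.
exact: mul_conjC_ge0.
Qed.

(** At [w] the new form is [form f w w - form f w v * form f v w / form f v v], nonnegative by
    Cauchy-Schwarz. A rank-one term is thus split off without losing positivity. *)
Lemma fpsd_schur f v : fpsd f -> 0 < form f v v ->
  fpsd (fun x y => f x y - mulfv f v x * (mulfv f v y)^* / form f v v).
Proof.
move=> pf c0; have [hf p0] := pf; set c := form f v v in c0 *.
have cr : c^* = c by rewrite form_conj.
split=> [x y|w].
  by rewrite rmorphB /= hf !rmorphM /= fmorphV /= conjCK cr [X in X / _]mulrC.
have -> : form (fun x y => f x y - mulfv f v x * (mulfv f v y)^* / c) w w =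
  form (fun x y => 1 * f x y + (- c^-1) * (mulfv f v x * (mulfv f v y)^*)) w w.
  by apply: eq_bigr => x _; apply: eq_bigr => y _; congr (_ * _ * _); ring.
rewrite form_lin mul1r form_rank1 -form_mulfv.
have -> : \sum_y (mulfv f v y)^* * w y = form f v w.
  rewrite -form_conj// form_mulfv rmorph_sum; apply: eq_bigr => x _.
  by rewrite rmorphM /= conjCK mulrC.
rewrite mulNr subr_ge0 mulrC ler_pdivrMr//; exact: fpsd_cauchy_schwarz.
Qed.

Lemma fpsd_diag0 f : fpsd f -> (forall x, f x x = 0) -> forall x y, f x y = 0.
Proof.
move=> pf d0 x y; have := fpsd_entry x y pf; rewrite !d0 mul0r.
have [hf _] := pf; rewrite -(hf y x) => H.
have : f x y * (f x y)^* == 0 by rewrite eq_le H mul_conjC_ge0.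
by rewrite mul_conjC_eq0 => /eqP.
Qed.

Definition ftr f : C := \sum_x f x x.

Lemma ftr_ge0 f : fpsd f -> 0 <= ftr f.
Proof. by move=> pf; apply: sumr_ge0 => x _; exact: fpsd_diag_ge0. Qed.

Lemma ftr_eq0 f : fpsd f -> ftr f = 0 -> forall x y, f x y = 0.
Proof.
move=> pf t0; apply: (fpsd_diag0 pf) => x.
exact: (psumr_eq0P (fun x _ => fpsd_diag_ge0 x pf) t0).
Qed.

Lemma fpsd_sum (I : finType) (F : I -> T -> T -> C) :
  (forall i, fpsd (F i)) -> fpsd (fun x y => \sum_i F i x y).
Proof.
move=> pF; split=> [x y|v].
  by rewrite rmorph_sum /=; apply: eq_bigr => i _; case: (pF i) => ->.
have -> : form (fun x y => \sum_i F i x y) v v = \sum_i form (F i) v v.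
  rewrite /form [RHS]exchange_big /=; apply: eq_bigr => x _; rewrite [RHS]exchange_big /=.
  by apply: eq_bigr => y _; rewrite mulr_sumr mulr_suml.
by apply: sumr_ge0 => i _; case: (pF i).
Qed.

Lemma fpsd_scale a f : 0 <= a -> fpsd f -> fpsd (fun x y => a * f x y).
Proof.
move=> a0 [hf pf]; split=> [x y|v].
  by rewrite rmorphM /= hf (CrealP (ger0_real a0)).
have -> : form (fun x y => a * f x y) v v = a * form f v v.
  rewrite /form mulr_sumr; apply: eq_bigr => x _; rewrite mulr_sumr.
  by apply: eq_bigr => y _; ring.
exact: mulr_ge0.
Qed.

(** * Squared modulus, Hilbert-Schmidt norm and purity, as real numbers *)

Definition nsq (z : C) : R := complex.Re z ^+ 2 + complex.Im z ^+ 2.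

Definition hsnorm f : R := \sum_x \sum_y nsq (f x y).

(* [tr(f^2) / tr f]; equal to [0] when [tr f = 0], as then [f = 0]. *)
Definition purity f : R := hsnorm f / complex.Re (ftr f).

Lemma nsq_ge0 z : 0 <= nsq z.
Proof. by rewrite addr_ge0 ?sqr_ge0. Qed.

Lemma nsqE z : nsq z = complex.Re (z * z^*).
Proof. by case: z => a b; rewrite /nsq /=; ring. Qed.

Lemma cReM (z w : C) :
  complex.Re (z * w) = complex.Re z * complex.Re w - complex.Im z * complex.Im w.
Proof. by case: z w => a b [c d]. Qed.

Lemma cRe_sum (I : finType) (F : I -> C) :
  complex.Re (\sum_i F i) = \sum_i complex.Re (F i).
Proof. by rewrite raddf_sum. Qed.

Lemma cRe_le (z w : C) : z <= w -> complex.Re z <= complex.Re w.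
Proof. by rewrite lecE => /andP[]. Qed.

Lemma cIm_ge0 (z : C) : 0 <= z -> complex.Im z = 0.
Proof. by rewrite lecE => /andP[/eqP]. Qed.

Lemma fpsd_nsq f x y : fpsd f ->
  nsq (f x y) <= complex.Re (f x x) * complex.Re (f y y).
Proof.
move=> pf; have := cRe_le (fpsd_entry x y pf).
have [hf _] := pf; rewrite -(hf y x) -nsqE => /le_trans; apply.
by rewrite cReM (cIm_ge0 (fpsd_diag_ge0 x pf)) mul0r subr0.
Qed.

(** The bounds [|f x y|^2 <= f x x * f y y], summed over all entries, have the squared trace on the
    right. *)
Lemma hsnorm_le f : fpsd f -> hsnorm f <= complex.Re (ftr f) ^+ 2.
Proof.
move=> pf; rewrite /hsnorm /ftr cRe_sum expr2 big_distrl; apply: ler_sum => x _ /=.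
by rewrite mulr_sumr; apply: ler_sum => y _; exact: fpsd_nsq.
Qed.

Lemma hsnorm_ge0 f : 0 <= hsnorm f.
Proof. by apply: sumr_ge0 => x _; apply: sumr_ge0 => y _; exact: nsq_ge0. Qed.

Lemma purity_le f : fpsd f -> purity f <= complex.Re (ftr f).
Proof.
move=> pf; have := cRe_le (ftr_ge0 pf); rewrite /purity le_eqVlt => /orP[/eqP <-|p0].
  by rewrite invr0 mulr0.
by rewrite ler_pdivrMr// -expr2; exact: hsnorm_le.
Qed.

(* Equality in [hsnorm_le] saturates every entrywise Cauchy-Schwarz bound, so
   the Schur complement of a nonzero diagonal entry has zero diagonal. *)
Lemma pure_rank1 f : fpsd f -> ftr f = 1 -> hsnorm f = 1 ->
  exists u, forall x y, f x y = u x * (u y)^*.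
Proof.
move=> pf t1 h1; have [hf _] := pf.
have eqd x y : nsq (f x y) = complex.Re (f x x) * complex.Re (f y y).
  have H x1 : true -> \sum_y nsq (f x1 y) <=
      \sum_y complex.Re (f x1 x1) * complex.Re (f y y).
    by move=> _; apply: ler_sum => y1 _; exact: fpsd_nsq.
  have e0 : \sum_x \sum_y nsq (f x y) =
            \sum_x \sum_y complex.Re (f x x) * complex.Re (f y y).
    under [RHS]eq_bigr => x1 _ do rewrite -mulr_sumr.
    by rewrite -mulr_suml -cRe_sum -/(ftr f) -/(hsnorm f) t1 h1 mul1r.
  have e0' : \sum_x (\sum_y complex.Re (f x x) * complex.Re (f y y) - \sum_y nsq (f x y)) = 0.
    by rewrite sumrB -e0 subrr.
  have /eqP := psumr_eq0P (fun x1 h => eqbRL (subr_ge0 _ _) (H x1 h)) e0' (i := x) isT.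
  rewrite -sumrB => /eqP e1.
  have := psumr_eq0P (fun y1 _ => eqbRL (subr_ge0 _ _) (fpsd_nsq x y1 pf)) e1 (i := y) isT.
  by move/eqP; rewrite subr_eq0 => /eqP.
have [x0 x0P] : exists x, 0 < f x x.
  apply/not_existsP => H; have : ftr f = 0.
    rewrite /ftr big1 // => x _; apply/eqP; rewrite eq_le (fpsd_diag_ge0 x pf) andbT.
    by have := H x; rewrite lt0r fpsd_diag_ge0// andbT => /negP; rewrite negbK => /eqP ->.
  by rewrite t1 => /eqP; rewrite oner_eq0.
set c := f x0 x0.
have fc : form f (dirac_vec x0) (dirac_vec x0) = c by rewrite form_dirac.
have c0 : 0 < form f (dirac_vec x0) (dirac_vec x0) by rewrite fc.
have ps := fpsd_schur pf c0; rewrite fc in ps.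
have mE x : mulfv f (dirac_vec x0) x = f x x0 by rewrite /mulfv sum_mul_dirac.
have z0 : forall x y, f x y - mulfv f (dirac_vec x0) x * (mulfv f (dirac_vec x0) y)^* / c = 0.
  apply: (fpsd_diag0 ps) => x; rewrite mE; apply/eqP; rewrite subr_eq0 eq_sym.
  apply/eqP; rewrite -[RHS](mulfK (lt0r_neq0 x0P)); congr (_ / _).
  have := eqd x x0; rewrite nsqE => H.
  (* [eqd] compares real parts only; the numbers involved are nonnegative, so their imaginary parts
     vanish and it becomes an identity in [C]. *)
  have Ic := cIm_ge0 (ltW x0P); have Ix := cIm_ge0 (fpsd_diag_ge0 x pf).
  have In := cIm_ge0 (mul_conjC_ge0 (f x x0)).
  move: H In Ix Ic; rewrite -/c.
  case: (f x x0 * _) => a b; case: (f x x) => a' b'; case: c {fc c0 ps x0P} => a'' b'' /=.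
  by move=> -> -> -> ->; apply/eqP; rewrite eq_complex /= !mulr0 !mul0r subr0 addr0 !eqxx.
(* The vanishing Schur complement reads [f x y = f x x0 * (f y x0)^* / c]; each factor takes one
   [sqrtC c]. *)
exists (fun x => f x x0 / sqrtC c) => x y.
have := z0 x y; rewrite !mE => /eqP; rewrite subr_eq0 => /eqP ->.
have sr : (sqrtC c)^* = sqrtC c.
  by apply/CrealP/ger0_real; rewrite sqrtC_ge0 ltW.
rewrite rmorphM /= fmorphV /= sr -[in LHS](sqrtCK c) expr2 invfM; ring.
Qed.

End Forms.

(** The form of the pullback at [v] is that of [f] at [W], which sums [v] over the fibres of [h];
    [h] may be any map. *)
Lemma fpsd_comp (R : realType) (T T' : finType) (h : T' -> T) (f : T -> T -> R[i]) :
  fpsd f -> fpsd (fun x y => f (h x) (h y)).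
Proof.
move=> [hf pf]; split=> [x y|v]; first exact: hf.
pose W x : R[i] := \sum_t v t * dirac_vec R (h t) x.
have WE (a : T -> R[i]) : \sum_x a x * W x = \sum_t a (h t) * v t.
  under eq_bigr => x _ do rewrite mulr_sumr.
  rewrite exchange_big /=; apply: eq_bigr => t _.
  rewrite -(sum_mul_dirac (fun x => a x * v t)); apply: eq_bigr => x _; ring.
have -> : form (fun x y => f (h x) (h y)) v v = form f W W; last exact: pf.
rewrite /form.
under [RHS]eq_bigr => x _.
  rewrite WE; under eq_bigr => t _ do rewrite -mulrA.
  rewrite -mulr_sumr -[X in _^* * X]conjCK -rmorphM mulrC /=.
  over.
rewrite -rmorph_sum WE rmorph_sum; apply: eq_bigr => t _ /=.
rewrite rmorphM /= conjCK mulrC mulr_sumr; apply: eq_bigr => t' _.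
by rewrite mulrA.
Qed.

(** * Matrices as kernels, rank factorisation, partial trace over [C^k] *)

Section Matrices.
Variable R : realType.
Local Notation C := R[i].

Lemma ctrmx_form d (A : 'M[C]_d) (v : 'cV[C]_d) :
  (ctrmx v *m A *m v) 0 0 = form A (v^~ 0) (v^~ 0).
Proof.
rewrite mxE /form exchange_big; apply: eq_bigr => j _ /=.
by rewrite mxE mulr_suml; apply: eq_bigr => i _; rewrite !mxE.
Qed.

Lemma psdP d (A : 'M[C]_d) : psd A <-> fpsd A.
Proof.
split=> -[hA pA]; split.
- by move=> x y; rewrite -[in RHS]hA !mxE.
- move=> v; have := pA (\col_i v i); rewrite ctrmx_form.
  by congr (0 <= form _ _ _); apply/funext => i; rewrite mxE.
- by apply/matrixP => i j; rewrite !mxE hA.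
- by move=> v; rewrite ctrmx_form.
Qed.

Lemma opmK (T : finType) (f : T -> T -> C) : ope (opm f) = f.
Proof. by apply/funext => x; apply/funext => y; rewrite /ope mxE !enum_rankK. Qed.

Lemma opeK (T : finType) (A : 'M[C]_#|T|) : opm (ope A) = A.
Proof. by apply/matrixP => i j; rewrite mxE /ope !enum_valK. Qed.

Lemma ope_inj (T : finType) : injective (@ope R T).
Proof. by move=> A B e; rewrite -(opeK A) e opeK. Qed.

Lemma psd_ope (T : finType) (A : 'M[C]_#|T|) : psd A <-> fpsd (ope A).
Proof.
split=> [/psdP|pA]; first exact: fpsd_comp.
apply/psdP; have := fpsd_comp (@enum_val T T) pA.
by congr fpsd; apply/funext => i; apply/funext => j; rewrite /ope !enum_valK.
Qed.

Lemma ope_mul (T : finType) (A B : 'M[C]_#|T|) x y :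
  ope (A *m B) x y = \sum_z ope A x z * ope B z y.
Proof.
rewrite /ope mxE (reindex (@enum_rank T)) //=.
by exists enum_val => i _; [exact: enum_rankK|exact: enum_valK].
Qed.

Lemma ope_tr (T : finType) (A : 'M[C]_#|T|) : \tr A = ftr (ope A).
Proof.
rewrite /mxtrace (reindex (@enum_rank T)) //=.
by exists enum_val => i _; [exact: enum_rankK|exact: enum_valK].
Qed.

(* Each step removes [A v (A v)^* / (v^* A v)], which kills [v] and so lowers
   the rank. *)
Lemma psd_rank_factor k n (A : 'M[C]_n) : psd A -> (\rank A <= k)%N ->
  exists B : 'M[C]_(n, k), A = B *m ctrmx B.
Proof.
elim: k A => [|k IH] A pA rA.
  move: rA; rewrite leqn0 mxrank_eq0 => /eqP ->; exists 0.
  by rewrite mul0mx.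
have /psdP fA := pA; have [hA _] := pA.
have [[v v0]|nv] := pselect (exists v, 0 < form A v v); last first.
  have A0 : A = 0.
    apply/matrixP => i j; rewrite mxE; apply: (fpsd_diag0 fA) => {}i.
    apply/eqP/negPn/negP => Ai; apply: nv; exists (dirac_vec R i).
    by rewrite form_dirac lt0r Ai (fpsd_diag_ge0 i fA).
  by exists 0; rewrite mul0mx.
pose vc : 'cV[C]_n := \col_i v i; set c := form A v v in v0.
have cE : ctrmx vc *m A *m vc = c%:M.
  apply/matrixP => i j; rewrite !ord1 ctrmx_form [RHS]mxE eqxx mulr1n.
  by congr form; apply/funext => x; rewrite mxE.
have mE i : (A *m vc) i 0 = mulfv A v i.
  by rewrite mxE; apply: eq_bigr => j _; rewrite mxE.
have ctM (p q r : nat) (P : 'M[C]_(p, q)) (Q : 'M[C]_(q, r)) :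
    ctrmx (P *m Q) = ctrmx Q *m ctrmx P.
  by rewrite /ctrmx trmx_mul map_mxM.
pose A' := A - c^-1 *: (A *m vc *m ctrmx (A *m vc)).
have pA' : psd A'.
  apply/psdP; have := fpsd_schur fA v0; congr fpsd.
  apply/funext => i; apply/funext => j.
  rewrite /A' !mxE big_ord1 !mxE -/c; congr (_ - _).
  by rewrite mulrC -!mE !mxE.
have A'E : A' = (1%:M - c^-1 *: (A *m vc *m ctrmx vc)) *m A.
  by rewrite /A' mulmxBl mul1mx -scalemxAl ctM hA !mulmxA.
have A'v : A' *m vc = 0.
  rewrite /A' mulmxBl -scalemxAl ctM hA -!mulmxA (mulmxA (ctrmx vc)) cE.
  rewrite (mulmxA A) mul_mx_scalar scalerA mulVf ?scale1r ?subrr //.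
  exact: lt0r_neq0.
have sA' : (A' <= A)%MS by rewrite A'E submxMl.
have rA' : (\rank A' <= k)%N.
  rewrite -ltnS; apply: leq_trans rA; rewrite ltn_neqAle mxrankS // andbT.
  (* Equal ranks would give [A = Z *m A']; as [A'] kills [vc], the number [c] would be zero. *)
  rewrite (mxrank_leqif_sup sA'); apply/negP => /submxP[Z AZ].
  have : c%:M = 0 :> 'M[C]_1 by rewrite -cE -mulmxA AZ -mulmxA A'v !mulmx0.
  by move/matrixP/(_ 0 0); rewrite !mxE eqxx mulr1n => c0; rewrite c0 ltxx in v0.
have [B' B'E] := IH _ pA' rA'.
have sr : (sqrtC c)^* = sqrtC c.
  by apply/CrealP/ger0_real; rewrite sqrtC_ge0 ltW.
(* The removed rank-one term supplies the additional column. *)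
pose B : 'M[C]_(n, 1 + k) := row_mx ((sqrtC c)^-1 *: (A *m vc)) B'.
suff BE : A = B *m ctrmx B by exists B.
rewrite /ctrmx /B tr_row_mx map_col_mx mul_row_col -/(ctrmx B') -B'E.
rewrite linearZ /= map_mxZ /= fmorphV /= sr -scalemxAl -scalemxAr scalerA -/(ctrmx _).
by rewrite -invfM -expr2 sqrtCK /A' addrC subrK.
Qed.

Definition ftr2 (n k : nat) (f : 'I_n * 'I_k -> 'I_n * 'I_k -> C) : 'M[C]_n :=
  \matrix_(a, a') \sum_(b : 'I_k) f (a, b) (a', b).

Lemma tr2_opm n k (f : 'I_n * 'I_k -> 'I_n * 'I_k -> C) : tr2 (opm f) = ftr2 f.
Proof. by apply/matrixP => a a'; rewrite !mxE opmK. Qed.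

Lemma ftr2_tr n k (f : 'I_n * 'I_k -> 'I_n * 'I_k -> C) : \tr (ftr2 f) = ftr f.
Proof.
rewrite /mxtrace; under eq_bigr => a _ do rewrite mxE.
by rewrite pair_bigA; apply: eq_bigr => -[].
Qed.

Lemma ftr2_sum n k (I : finType) (a : I -> C)
    (F : I -> 'I_n * 'I_k -> 'I_n * 'I_k -> C) :
  ftr2 (fun x y => \sum_i a i * F i x y) = \sum_i a i *: ftr2 (F i).
Proof.
apply/matrixP => x y; rewrite mxE summxE exchange_big /=; apply: eq_bigr => i _.
by rewrite !mxE mulr_sumr.
Qed.

(** Reshaping a vector into an [n] by [k] matrix links pure states of one party with operators of
    rank at most [k]. *)
Lemma ftr2_rank1 n k (u : 'I_n * 'I_k -> C) (B := \matrix_(a, b) u (a, b)) :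
  ftr2 (fun x y => u x * (u y)^*) = B *m ctrmx B.
Proof.
by apply/matrixP => a a'; rewrite !mxE; apply: eq_bigr => b _; rewrite !mxE.
Qed.

Lemma psd_mul_ctrmx n k (B : 'M[C]_(n, k)) : psd (B *m ctrmx B).
Proof.
apply/psdP; have := @fpsd_sum R 'I_n 'I_k _ (fun b => @fpsd_rank1 R 'I_n (fun a => B a b)).
congr fpsd; apply/funext => i; apply/funext => j; rewrite mxE.
by apply: eq_bigr => b _; rewrite !mxE.
Qed.

End Matrices.

(** * Index tuples of several parties and the action of permutations on them *)

Section Parties.
Variables (n k : nat).
Local Notation P := ('I_n * 'I_k)%type.

Lemma pcons0 N (s : P) (y : {ffun 'I_N -> P}) : pcons s y ord0 = s.
Proof. by rewrite ffunE unlift_none. Qed.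

Lemma pconsS N (s : P) (y : {ffun 'I_N -> P}) j : pcons s y (lift ord0 j) = y j.
Proof. by rewrite ffunE liftK. Qed.

Definition ptail N (x : {ffun 'I_N.+1 -> P}) : {ffun 'I_N -> P} :=
  [ffun j => x (lift ord0 j)].

Lemma pcons_eta N (x : {ffun 'I_N.+1 -> P}) : pcons (x ord0) (ptail x) = x.
Proof.
by apply/ffunP => i; rewrite ffunE; case: unliftP => [j|] ->; rewrite ?ffunE.
Qed.

Lemma ptailK N (s : P) (y : {ffun 'I_N -> P}) : ptail (pcons s y) = y.
Proof. by apply/ffunP => j; rewrite ffunE pconsS. Qed.

Lemma sum_pcons (V : nmodType) N (F : {ffun 'I_N.+1 -> P} -> V) :
  \sum_x F x = \sum_s \sum_y F (pcons s y).
Proof.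
rewrite pair_bigA /= (reindex (fun p : P * {ffun 'I_N -> P} => pcons p.1 p.2)) //=.
exists (fun x : {ffun 'I_N.+1 -> P} => (x ord0, ptail x)) => [[s y] _|x _] /=.
  by rewrite pcons0 ptailK.
exact: pcons_eta.
Qed.

Definition pact N (s : 'S_N) (x : {ffun 'I_N -> P}) : {ffun 'I_N -> P} :=
  [ffun i => x (s i)].

Lemma pactM N (s t : 'S_N) x : pact s (pact t x) = pact (s * t)%g x.
Proof. by apply/ffunP => i; rewrite !ffunE permM. Qed.

Lemma pact1 N (x : {ffun 'I_N -> P}) : pact 1%g x = x.
Proof. by apply/ffunP => i; rewrite !ffunE perm1. Qed.

(** Permutations of the remaining parties extend to all parties, so symmetry survives contraction of
    the first one. *)
Lemma pact_pcons N (s : 'S_N) (z : P) x :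
  pact (lift_perm ord0 ord0 s) (pcons z x) = pcons z (pact s x).
Proof.
apply/ffunP => i; rewrite ffunE; case: (unliftP ord0 i) => [j|] ->.
  by rewrite lift_perm_lift !pconsS ffunE.
by rewrite lift_perm_id !pcons0.
Qed.

(** Contractions and marginals act on the first party; this transposition brings the second one to
    the front. *)
Lemma pcons_swap N (z s : P) (y : {ffun 'I_N -> P}) :
  pcons z (pcons s y) = pact (tperm ord0 (lift ord0 ord0)) (pcons s (pcons z y)).
Proof.
apply/ffunP => i; rewrite [RHS]ffunE; case: tpermP => [->|->|].
- by rewrite pcons0 pconsS pcons0.
- by rewrite pcons0 pconsS pcons0.
case: (unliftP ord0 i) => [j|] -> // _; rewrite !pconsS.
by case: (unliftP ord0 j) => [l|] -> // _; rewrite !pconsS.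
Qed.

End Parties.

(** * The semidefinite program in terms of kernels *)

Section Extensions.
Variables (R : realType) (n m k : nat).
Local Notation C := R[i].
Local Notation P := ('I_n * 'I_k)%type.
Variables (Lam : {linear 'M[C]_n -> 'M[C]_m}) (Y : 'M[C]_m).

(* [sdp_feasible] without the normalisation [\tr Phi = 1], for kernels. *)
Definition sdp_cone N (f : {ffun 'I_N.+1 -> P} -> {ffun 'I_N.+1 -> P} -> C) :=
  [/\ fpsd f, (forall s x y, f (pact s x) y = f x y)
    & forall y y', Lam (ftr2 (fun s s' => f (pcons s y) (pcons s' y'))) =
                   (\sum_s f (pcons s y) (pcons s y')) *: Y].

Definition marg N (f : {ffun 'I_N.+1 -> P} -> {ffun 'I_N.+1 -> P} -> C) (s s' : P) : C :=
  \sum_y f (pcons s y) (pcons s' y).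

Lemma ope_sum (T I : finType) (F : I -> 'M[C]_#|T|) x y :
  ope (\sum_i F i) x y = \sum_i ope (F i) x y.
Proof. by rewrite /ope summxE. Qed.

Lemma ope_scale (T : finType) a (M : 'M[C]_#|T|) x y : ope (a *: M) x y = a * ope M x y.
Proof. by rewrite /ope mxE. Qed.

Lemma Vperm_mul_ope N (s : 'S_N.+1) (M : 'M[C]_#|{: {ffun 'I_N.+1 -> P}}|) x y :
  ope (Vperm R n k s *m M) x y = ope M (pact s^-1%g x) y.
Proof.
rewrite ope_mul (bigD1 (pact s^-1%g x)) //= big1 ?addr0 => [|z zx].
  by rewrite opmK -/(pact s _) pactM mulgV pact1 eqxx mul1r.
rewrite opmK -/(pact s z) [x == _]negbTE ?mul0r //.
by apply: contra_neq zx => ->; rewrite pactM mulVg pact1.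
Qed.

Lemma mul_Vperm_ope N (s : 'S_N.+1) (M : 'M[C]_#|{: {ffun 'I_N.+1 -> P}}|) x y :
  ope (M *m Vperm R n k s) x y = ope M x (pact s y).
Proof.
rewrite ope_mul (bigD1 (pact s y)) //= big1 ?addr0 => [|z zx].
  by rewrite opmK eqxx mulr1.
by rewrite opmK -/(pact s y) (negbTE zx) mulr0.
Qed.

Lemma Vperm_Psym N (s : 'S_N.+1) : Vperm R n k s *m Psym R n k N = Psym R n k N.
Proof.
rewrite /Psym -scalemxAr; congr (_ *: _); rewrite mulmx_sumr [RHS](reindex_inj (mulgI s)) /=.
apply: eq_bigr => t _; apply: ope_inj; apply/funext => x; apply/funext => y.
rewrite Vperm_mul_ope !opmK -!/(pact _ _) -pactM; congr (_%:R); congr nat_of_bool.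
apply/eqP/eqP => [<-|->]; first by rewrite pactM mulgV pact1.
by rewrite pactM mulVg pact1.
Qed.

Lemma fact_neq0 N : N`!%:R != 0 :> C.
Proof. by rewrite pnatr_eq0 -lt0n fact_gt0. Qed.

(** Support in the symmetric subspace amounts to invariance under permuting the row index alone: one
    direction uses [Vperm s *m Psym = Psym], the other averages over the group. *)
Lemma sdp_feasibleE N (Phi : 'M[C]_#|{: {ffun 'I_N.+1 -> P}}|) :
  sdp_feasible Lam Y Phi <-> sdp_cone (ope Phi) /\ ftr (ope Phi) = 1.
Proof.
have LamE : LamA Lam Phi = kronY Y (trA Phi) <->
    forall y y', Lam (ftr2 (fun s s' => ope Phi (pcons s y) (pcons s' y'))) =
                   (\sum_s ope Phi (pcons s y) (pcons s y')) *: Y.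
  split=> [/(congr1 (@ope _ _)) E y y'|E].
    apply/matrixP => i i'; have /(congr1 (fun g => g (i, y) (i', y'))) := E.
    by rewrite /LamA /kronY !opmK /= /Lamt tr2_opm => ->; rewrite mxE mulrC.
  apply: ope_inj; apply/funext => -[i y]; apply/funext => -[i' y'].
  by rewrite /LamA /kronY !opmK /= /Lamt tr2_opm E mxE mulrC.
rewrite /sdp_feasible ope_tr; split=> [[pP tP sP /LamE lP]|[[/psd_ope pP sP /LamE lP] tP]].
  split=> //; split=> //; first exact/psd_ope.
  have VP s : Vperm R n k s *m Phi = Phi by rewrite -[in LHS]sP !mulmxA Vperm_Psym.
  by move=> s x y; rewrite -[in RHS](VP s^-1%g) Vperm_mul_ope invgK.
have [hP _] := iffLR (psd_ope _) pP.
have sum1 (a : C) : (N.+1)`!%:R^-1 * (\sum_(s : 'S_N.+1) a) = a.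
  by rewrite sumr_const card_Sn -[X in _ * X]mulr_natl mulKf ?fact_neq0.
have PP : Psym R n k N *m Phi = Phi.
  apply: ope_inj; apply/funext => x; apply/funext => y.
  rewrite -[RHS]sum1 /Psym -scalemxAl mulmx_suml ope_scale ope_sum; congr (_ * _).
  by apply: eq_bigr => s _; rewrite Vperm_mul_ope sP.
split=> //; rewrite PP.
apply: ope_inj; apply/funext => x; apply/funext => y.
rewrite -[RHS]sum1 /Psym -scalemxAr mulmx_sumr ope_scale ope_sum; congr (_ * _).
apply: eq_bigr => s _.
(* Hermiticity carries the invariance over to the column index. *)
by rewrite mul_Vperm_ope -hP sP hP.
Qed.

(** [XA] is the identity on the other parties and on [C^k], so these can be traced out first. *)
Lemma XA_tr N (X : 'M[C]_n) (Phi : 'M[C]_#|{: {ffun 'I_N.+1 -> P}}|) :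
  \tr (XA k N X *m Phi) = \tr (X *m ftr2 (marg (ope Phi))).
Proof.
rewrite ope_tr /ftr sum_pcons.
transitivity (\sum_(s : P) \sum_(s' : P)
   X s.1 s'.1 * (s.2 == s'.2)%:R * marg (ope Phi) s' s).
  apply: eq_bigr => s _; rewrite /marg.
  under [RHS]eq_bigr => s' _ do rewrite mulr_sumr.
  rewrite [RHS]exchange_big /=; apply: eq_bigr => y _.
  rewrite ope_mul sum_pcons; apply: eq_bigr => s' _.
  rewrite (bigD1 y) //= big1 ?addr0 => [|y' yy'].
    rewrite !opmK !pcons0; congr (_ * _).
    have -> : [forall j, pcons s y (lift ord0 j) == pcons s' y (lift ord0 j)].
      by apply/forallP => j; rewrite !pconsS.
    by rewrite mulr1.
  rewrite opmK; case: forallP => [H|_]; last by rewrite mulr0 mul0r.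
  case/eqP: yy'; apply/ffunP => j.
  by have /eqP := H j; rewrite !pconsS.
have -> : \tr (X *m ftr2 (marg (ope Phi))) =
   \sum_(a : 'I_n) \sum_(b : 'I_k) \sum_(a' : 'I_n) X a a' * marg (ope Phi) (a', b) (a, b).
  apply: eq_bigr => a _; rewrite mxE exchange_big /=; apply: eq_bigr => a' _.
  by rewrite mxE mulr_sumr.
rewrite [RHS]pair_bigA; apply: eq_bigr => -[a b] _ /=.
transitivity (\sum_a' \sum_b' X a a' * (b == b')%:R * marg (ope Phi) (a', b') (a, b)).
  by rewrite pair_bigA; apply: eq_bigr => -[].
apply: eq_bigr => a' _; rewrite (bigD1 b) //= eqxx mulr1 big1 ?addr0 // => b' bb'.
by rewrite eq_sym (negbTE bb') mulr0 mul0r.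
Qed.

End Extensions.

(** * Operations that preserve the constraints: contraction and partial trace *)

Section Cone.
Variables (R : realType) (n m k : nat).
Local Notation C := R[i].
Local Notation P := ('I_n * 'I_k)%type.
Local Notation op N := ({ffun 'I_N -> P} -> {ffun 'I_N -> P} -> C).
Variables (Lam : {linear 'M[C]_n -> 'M[C]_m}) (Y : 'M[C]_m).
Local Notation cone := (sdp_cone Lam Y).

(** The unnormalised state of the other parties once the first is found in [v]. *)
Definition contract N (v : P -> C) (f : op N.+1) : op N := fun x y =>
  form (fun z z' => f (pcons z x) (pcons z' y)) v v.

Lemma cone_pactr N (f : op N.+1) s x y : cone f -> f x (pact s y) = f x y.
Proof. by move=> [[hf _] sf _]; rewrite -hf sf hf. Qed.

(** Exchanging two parties in the row index alone is what bosonic symmetry adds to invariance under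
    relabelling the parties. *)
Lemma cone_swapl N (f : op N.+2) z s y x : cone f ->
  f (pcons z (pcons s y)) x = f (pcons s (pcons z y)) x.
Proof. by move=> [_ sf _]; rewrite pcons_swap sf. Qed.

Lemma cone_swap N (f : op N.+2) z s y z' s' y' : cone f ->
  f (pcons z (pcons s y)) (pcons z' (pcons s' y')) =
  f (pcons s (pcons z y)) (pcons s' (pcons z' y')).
Proof.
by move=> cf; rewrite pcons_swap (pcons_swap z') (cone_pactr _ _ _ cf); case: cf => _ ->.
Qed.

(** By symmetry the second party may be contracted instead, which leaves the first one in place for
    the constraint. *)
Lemma contractE N v (f : op N.+2) s y s' y' : cone f ->
  contract v f (pcons s y) (pcons s' y') =
  \sum_(p : P * P) ((v p.1)^* * v p.2) *
    f (pcons s (pcons p.1 y)) (pcons s' (pcons p.2 y')).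
Proof.
move=> cf; rewrite /contract /form pair_bigA; apply: eq_bigr => -[z z'] _ /=.
by rewrite (cone_swap _ _ _ _ _ _ cf); ring.
Qed.

Lemma contract_cone N v (f : op N.+2) : cone f -> cone (contract v f).
Proof.
move=> cf; have [[hf pf] sf lf] := cf; split.
- split=> [x y|w].
    rewrite /contract /form rmorph_sum exchange_big /=; apply: eq_bigr => z _.
    rewrite rmorph_sum; apply: eq_bigr => z' _ /=.
    by rewrite !rmorphM /= conjCK hf; ring.
  (* Testing the contraction on [w] is testing [f] on the product of [v] and [w]. *)
  have := pf (fun x => v (x ord0) * w (ptail x)); congr (0 <= _).
  rewrite {1}/form sum_pcons exchange_big; apply: eq_bigr => x _ /=.
  transitivity (\sum_z \sum_z' \sum_y
      (v z * w x)^* * f (pcons z x) (pcons z' y) * (v z' * w y)).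
    apply: eq_bigr => z _; rewrite sum_pcons; apply: eq_bigr => z' _.
    by apply: eq_bigr => y _; rewrite !pcons0 !ptailK.
  under [LHS]eq_bigr => z _ do rewrite exchange_big.
  rewrite exchange_big /=; apply: eq_bigr => y _.
  rewrite /contract /form mulr_sumr mulr_suml; apply: eq_bigr => z _.
  rewrite mulr_sumr mulr_suml; apply: eq_bigr => z' _; rewrite rmorphM /=; ring.
- move=> s x y; rewrite /contract; congr form; apply/funext => z; apply/funext => z'.
  by rewrite -pact_pcons sf.
move=> y y'.
(* The constraint on [f] holds at each pair of indices of the other parties, so it can be combined
   linearly over those of the contracted one. *)
have -> : (fun s s' : P => contract v f (pcons s y) (pcons s' y')) =
  fun s s' => \sum_(p : P * P) ((v p.1)^* * v p.2) *
    f (pcons s (pcons p.1 y)) (pcons s' (pcons p.2 y')).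
  by apply/funext => s; apply/funext => s'; rewrite contractE.
rewrite ftr2_sum linear_sum /=.
under [in RHS]eq_bigr => s _ do rewrite contractE//.
rewrite exchange_big /= scaler_suml; apply: eq_bigr => p _.
by rewrite linearZ /= lf -mulr_sumr scalerA.
Qed.

Lemma cone_sum N (I : finType) (F : I -> op N.+1) :
  (forall i, cone (F i)) -> cone (fun x y => \sum_i F i x y).
Proof.
move=> cF; split.
- by apply: fpsd_sum => i; case: (cF i).
- by move=> s x y; apply: eq_bigr => i _; case: (cF i) => _ ->.
move=> y y'.
have -> : (fun s s' : P => \sum_i F i (pcons s y) (pcons s' y')) =
  fun s s' => \sum_i 1 * F i (pcons s y) (pcons s' y').
  by apply/funext => s; apply/funext => s'; apply: eq_bigr => i _; rewrite mul1r.
rewrite ftr2_sum linear_sum exchange_big /= scaler_suml; apply: eq_bigr => i _.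
by rewrite scale1r; case: (cF i) => _ _ ->.
Qed.

Definition ptrace N (f : op N.+1) : op N := fun x y => \sum_z f (pcons z x) (pcons z y).

(** A partial trace is the sum of the contractions with the basis vectors. *)
Lemma ptrace_cone N (f : op N.+2) : cone f -> cone (ptrace f).
Proof.
move=> cf; have := cone_sum (fun z => contract_cone (dirac_vec R z) cf).
congr sdp_cone; apply/funext => x; apply/funext => y; apply: eq_bigr => z _.
by rewrite /contract form_dirac.
Qed.

Lemma marg_ptrace N (f : op N.+2) : cone f -> marg (ptrace f) = marg f.
Proof.
move=> cf; apply/funext => s; apply/funext => s'; rewrite /marg sum_pcons exchange_big.
by apply: eq_bigr => z _; apply: eq_bigr => y _; exact: cone_swap.
Qed.

Lemma marg_psd N (f : op N.+1) : fpsd f -> fpsd (marg f).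
Proof. by move=> pf; apply: fpsd_sum => y; exact: (fpsd_comp (fun s => pcons s y) pf). Qed.

Lemma ftr_marg N (f : op N.+1) : ftr (marg f) = ftr f.
Proof. by rewrite /ftr sum_pcons. Qed.

Lemma marg_Lam N (f : op N.+1) : cone f -> Lam (ftr2 (marg f)) = ftr f *: Y.
Proof.
move=> [_ _ lf].
have -> : marg f = fun s s' => \sum_y 1 * f (pcons s y) (pcons s' y).
  by apply/funext => s; apply/funext => s'; apply: eq_bigr => y _; rewrite mul1r.
rewrite ftr2_sum linear_sum /ftr sum_pcons exchange_big scaler_suml /=.
by apply: eq_bigr => y _; rewrite scale1r lf.
Qed.

(** * Tensor powers of a pure state *)

Definition prodvec (u : P -> C) N (x : {ffun 'I_N -> P}) : C := \prod_i u (x i).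

Definition prodop (u : P -> C) N : op N := fun x y => prodvec u x * (prodvec u y)^*.

Lemma prodvec_pcons u N s (y : {ffun 'I_N -> P}) :
  prodvec u (pcons s y) = u s * prodvec u y.
Proof.
rewrite /prodvec big_ord_recl pcons0; congr (_ * _).
by apply: eq_bigr => i _; rewrite pconsS.
Qed.

Lemma prodop_pcons u N s s' (y y' : {ffun 'I_N -> P}) :
  prodop u (pcons s y) (pcons s' y') = prodop u y y' * (u s * (u s')^*).
Proof. by rewrite /prodop !prodvec_pcons rmorphM /=; ring. Qed.

Lemma ftr_prodop u N : \sum_s u s * (u s)^* = 1 -> ftr (prodop u (N := N)) = 1.
Proof.
move=> u1; elim: N => [|N IH].
  rewrite /ftr (eq_bigr (fun=> 1)) => [|x _].
    by rewrite sumr_const card_ffun card_ord expn0.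
  by rewrite /prodop /prodvec !big_ord0 rmorph1 mulr1.
rewrite /ftr sum_pcons exchange_big -IH; apply: eq_bigr => y _ /=.
by under eq_bigr => s _ do rewrite prodop_pcons; rewrite -mulr_sumr u1 mulr1.
Qed.

Lemma ftr2_scale a (f : P -> P -> C) : ftr2 (fun x y => a * f x y) = a *: ftr2 f.
Proof. by apply/matrixP => x y; rewrite !mxE mulr_sumr. Qed.

(** Permutations fix a tensor power, and splitting off its first factor leaves a scalar that
    multiplies both sides of the constraint. *)
Lemma prodop_cone u N : \sum_s u s * (u s)^* = 1 ->
  Lam (ftr2 (fun s s' => u s * (u s')^*)) = Y -> cone (prodop u (N := N.+1)).
Proof.
move=> u1 uY; split; first exact: fpsd_rank1.
  move=> s x y; congr (_ * _); rewrite /prodvec [RHS](reindex_inj (@perm_inj _ s)).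
  by apply: eq_bigr => i _; rewrite ffunE.
move=> y y'.
have -> : (fun s s' : P => prodop u (pcons s y) (pcons s' y')) =
  fun s s' => prodop u y y' * (u s * (u s')^*).
  by apply/funext => s; apply/funext => s'; rewrite prodop_pcons.
rewrite ftr2_scale linearZ /= uY; congr (_ *: _).
by under eq_bigr => s _ do rewrite prodop_pcons; rewrite -mulr_sumr u1 mulr1.
Qed.

Lemma marg_prodop u N : \sum_s u s * (u s)^* = 1 ->
  marg (prodop u (N := N.+1)) = fun s s' => u s * (u s')^*.
Proof.
move=> u1; apply/funext => s; apply/funext => s'; rewrite /marg.
under eq_bigr => y _ do rewrite prodop_pcons.
by rewrite -mulr_suml -/(ftr _) ftr_prodop// mul1r.
Qed.

(** * Comparison of the optimal values *)

Variable X : 'M[C]_n.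

Lemma xi_le_xi_hier N : (xi k X Lam Y <= xi_hier k X Lam Y N)%E.
Proof.
apply: ge_ereal_sup => _ [rho [rY r1 pr rk] <-].
have [B BE] := psd_rank_factor pr rk.
pose u (s : P) := B s.1 s.2.
have uE : ftr2 (fun s s' => u s * (u s')^*) = rho.
  by rewrite ftr2_rank1 BE; congr (_ *m ctrmx _); apply/matrixP => a b; rewrite mxE.
have u1 : \sum_s u s * (u s)^* = 1 by rewrite -r1 -uE ftr2_tr.
apply: ereal_sup_ubound; exists (opm (prodop u (N := N.+1))).
  apply/sdp_feasibleE; rewrite opmK ftr_prodop//; split=> //.
  by apply: prodop_cone => //; rewrite uE.
by rewrite XA_tr opmK marg_prodop// uE.
Qed.

Lemma xi_hier_decr N : (xi_hier k X Lam Y N.+1 <= xi_hier k X Lam Y N)%E.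
Proof.
apply: ge_ereal_sup => _ [Phi /sdp_feasibleE[cP t1] <-].
apply: ereal_sup_ubound; exists (opm (ptrace (ope Phi))).
  apply/sdp_feasibleE; rewrite opmK; split; first exact: ptrace_cone.
  by rewrite -ftr_marg marg_ptrace// ftr_marg.
by rewrite !XA_tr opmK marg_ptrace.
Qed.

End Cone.

(** * Limits of bounded sequences along an ultrafilter *)

Section UltraLimits.
Import numFieldNormedType.Exports.
Variables (R : realType) (U : set_system nat) (UU : UltraFilter U).
Local Notation C := R[i].

Lemma ultra_fmap (T : Type) (u : nat -> T) : UltraFilter (u @ U).
Proof.
split; first exact: fmap_proper_filter.
move=> G GF sG; rewrite predeqE => A; split=> [GA|]; last exact: sG.
have [//|nA] := in_ultra_setVsetC (u @^-1` A) UU.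
have /filter_ex [x [xA xnA]] : G (A `&` ~` A).
  by apply: filterI => //; apply: sG; rewrite /fmap /= preimage_setC.
by [].
Qed.

(** Compactness of [[-M, M]] in ultrafilter form: finitely many sequences converge along the same
    [U], without extracting subsequences. *)
Lemma ultra_bounded_cvg (u : nat -> R) (M : R) :
  (forall j, `|u j| <= M) -> exists l : R, u @ U --> l.
Proof.
move=> uM; have cM := @segment_compact R (- M) M; rewrite compact_ultra /= in cM.
have [|l [_ ul]] := cM _ (ultra_fmap u); last by exists l.
suff : U (u @^-1` `[- M, M]) by [].
by apply: filterE => j; rewrite /= in_itv /= -ler_norml; exact: uM.
Qed.

(** Stated on real and imaginary parts, so that only the topology of [R] is involved. *)
Definition ccvg (z : nat -> C) (l : C) :=
  (complex.Re (z j) @[j --> U] --> complex.Re l) /\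
  (complex.Im (z j) @[j --> U] --> complex.Im l).

Lemma ccvg_cst a : ccvg (fun=> a) a.
Proof. by split; exact: cvg_cst. Qed.

Lemma cReD (z w : C) : complex.Re (z + w) = complex.Re z + complex.Re w.
Proof. by case: z w => a b []. Qed.

Lemma cImD (z w : C) : complex.Im (z + w) = complex.Im z + complex.Im w.
Proof. by case: z w => a b []. Qed.

Lemma cImM (z w : C) :
  complex.Im (z * w) = complex.Re z * complex.Im w + complex.Im z * complex.Re w.
Proof. by case: z w => a b []. Qed.

Lemma ccvgD z w a b : ccvg z a -> ccvg w b -> ccvg (fun j => z j + w j) (a + b).
Proof.
move=> [z1 z2] [w1 w2]; split.
  by rewrite cReD; under eq_fun do rewrite cReD; exact: cvgD.
by rewrite cImD; under eq_fun do rewrite cImD; exact: cvgD.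
Qed.

Lemma ccvgM z w a b : ccvg z a -> ccvg w b -> ccvg (fun j => z j * w j) (a * b).
Proof.
move=> [z1 z2] [w1 w2]; split.
  by rewrite cReM; under eq_fun do rewrite cReM; apply: cvgB; exact: cvgM.
by rewrite cImM; under eq_fun do rewrite cImM; apply: cvgD; exact: cvgM.
Qed.

Lemma ccvg_conj z a : ccvg z a -> ccvg (fun j => (z j)^*) a^*.
Proof.
have IN (w : C) : complex.Im w^* = - complex.Im w by case: w.
have RN (w : C) : complex.Re w^* = complex.Re w by case: w.
move=> [z1 z2]; split; first by rewrite RN; under eq_fun do rewrite RN.
by rewrite IN; under eq_fun do rewrite IN; exact: cvgN.
Qed.

Lemma ccvg_sum (I : finType) (z : nat -> I -> C) (a : I -> C) :
  (forall i, ccvg (z^~ i) (a i)) -> ccvg (fun j => \sum_i z j i) (\sum_i a i).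
Proof.
move=> H; elim: (index_enum I) => [|i s IH].
  by rewrite big_nil; under eq_fun do rewrite big_nil; exact: ccvg_cst.
by rewrite big_cons; under eq_fun do rewrite big_cons; exact: ccvgD.
Qed.

Lemma ccvg_ge0 z a : ccvg z a -> (forall j, 0 <= z j) -> 0 <= a.
Proof.
move=> [z1 z2] z0; rewrite lecE; apply/andP; split.
  have : complex.Im (z j) @[j --> U] --> 0.
    by under eq_fun => j do rewrite cIm_ge0//; exact: cvg_cst.
  by move/(cvg_unique (@norm_hausdorff _ _) z2) => ->.
rewrite -(cvg_lim (@norm_hausdorff _ _) z1); apply: limr_ge.
  by apply/cvg_ex; exists (complex.Re a).
by apply: filterE => j; exact: cRe_le.
Qed.

Lemma ccvg_unique z a b : ccvg z a -> ccvg z b -> a = b.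
Proof.
move=> [z1 z2] [w1 w2]; apply/eqP; rewrite eq_complex.
by rewrite (cvg_unique (@norm_hausdorff _ _) z1 w1) (cvg_unique (@norm_hausdorff _ _) z2 w2) !eqxx.
Qed.

End UltraLimits.

(** * Value against defect of purity for states of a single party *)

Section PurityGap.
Import numFieldNormedType.Exports.
Variables (R : realType) (n m k : nat).
Local Notation C := R[i].
Local Notation P := ('I_n * 'I_k)%type.
Variables (Lam : {linear 'M[C]_n -> 'M[C]_m}) (Y : 'M[C]_m) (X : 'M[C]_n).

(** With fixed coefficients on the entries of [M], this makes [Lam] commute with entrywise
    limits. *)
Lemma linear_entry (M : 'M[C]_n) i j :
  Lam M i j = \sum_a \sum_b M a b * Lam (delta_mx a b) i j.
Proof.
rewrite {1}(matrix_sum_delta M) linear_sum summxE; apply: eq_bigr => a _.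
rewrite linear_sum summxE; apply: eq_bigr => b _.
by rewrite linearZ mxE.
Qed.

(** Such an [s] is a rank-one projector; its partial trace is [B *m ctrmx B] with [B] of [k]
    columns, hence of rank at most [k]. *)
Lemma pure_feasible_le_xi (s : P -> P -> C) : fpsd s -> ftr s = 1 -> hsnorm s = 1 ->
  Lam (ftr2 s) = Y -> ((complex.Re (\tr (X *m ftr2 s)))%:E <= xi k X Lam Y)%E.
Proof.
move=> ps t1 h1 sY; apply: ereal_sup_ubound; exists (ftr2 s) => //.
have [u uE] := pure_rank1 ps t1 h1.
have uE' : s = fun x y => u x * (u y)^* by apply/funext => x; apply/funext => y.
split=> //; first by rewrite ftr2_tr.
  by rewrite uE' ftr2_rank1; exact: psd_mul_ctrmx.
rewrite uE' ftr2_rank1; exact: leq_trans (mxrankM_maxl _ _) (rank_leq_col _).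
Qed.

(* Otherwise, an ultralimit of counterexamples for [K -> oo] is a pure
   feasible point of value at least [t]. *)
Lemma purity_gap_normalized t : (xi k X Lam Y < t%:E)%E -> exists2 K, 0 <= K &
  forall s : P -> P -> C, fpsd s -> ftr s = 1 -> Lam (ftr2 s) = Y ->
    complex.Re (\tr (X *m ftr2 s)) - t <= K * (1 - hsnorm s).
Proof.
move=> xt; apply/not_exists2P => H.
have {H} /choice[s sP] : forall j : nat, exists s : P -> P -> C,
    [/\ fpsd s, ftr s = 1, Lam (ftr2 s) = Y
      & j.+1%:R * (1 - hsnorm s) < complex.Re (\tr (X *m ftr2 s)) - t].
  move=> j; have [/negP|] := H j.+1%:R; first by rewrite ler0n.
  move=> /existsNP[s /not_implyP[ps /not_implyP[t1 /not_implyP[sY /negP]]]].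
  by rewrite -ltNge => lt; exists s.
have [U [UU oU]] := ultraFilterLemma (eventually_filter).
(* Diagonal entries are at most the trace 1, which bounds all entries and gives each a limit along
   [U]. *)
have e1 j x y : nsq (s j x y) <= 1.
  have [ps t1 _ _] := sP j; apply: le_trans (fpsd_nsq x y ps) _.
  have d0 z := cRe_le (fpsd_diag_ge0 z ps).
  have d1 z : complex.Re (s j z z) <= 1.
    have -> : 1 = complex.Re (ftr (s j)) by rewrite t1.
    by rewrite /ftr cRe_sum (bigD1 z) //= lerDl sumr_ge0.
  by rewrite -[1]mulr1 ler_pM ?d0 ?d1.
have lim (xy : P * P) : exists l, ccvg U (fun j => s j xy.1 xy.2) l.
  have [a aP] : exists a : R, complex.Re (s j xy.1 xy.2) @[j --> U] --> a.
    apply: (@ultra_bounded_cvg _ _ UU _ 1) => j; have := e1 j xy.1 xy.2.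
    by rewrite /nsq ler_norml => e; apply/andP; split; nra.
  have [b bP] : exists b : R, complex.Im (s j xy.1 xy.2) @[j --> U] --> b.
    apply: (@ultra_bounded_cvg _ _ UU _ 1) => j; have := e1 j xy.1 xy.2.
    by rewrite /nsq ler_norml => e; apply/andP; split; nra.
  by exists (Complex a b).
have {lim} /choice[L' L'P] := lim.
pose L x y := L' (x, y).
have LP x y : ccvg U (fun j => s j x y) (L x y) by exact: (L'P (x, y)).
have tr2L a b : ccvg U (fun j => ftr2 (s j) a b) (ftr2 L a b).
  by rewrite mxE; under eq_fun do rewrite mxE; exact: ccvg_sum.
have pL : fpsd L.
  split=> [x y|v].
    apply: (@ccvg_unique _ _ UU (fun j => (s j y x)^*)); first exact: ccvg_conj.
    by under eq_fun => j do (have [[-> _] _ _ _] := sP j); exact: LP.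
  apply: (@ccvg_ge0 _ _ UU (fun j => form (s j) v v)); last first.
    by move=> j; have [[_ ? ] _ _ _] := sP j.
  apply: ccvg_sum => // x; apply: ccvg_sum => // y.
  apply: ccvgM => //; last exact: ccvg_cst.
  by apply: ccvgM => //; exact: ccvg_cst.
have tL : ftr L = 1.
  apply: (@ccvg_unique _ _ UU (fun j => ftr (s j))); first exact: ccvg_sum.
  by under eq_fun => j do (have [_ -> _ _] := sP j); exact: ccvg_cst.
have YL : Lam (ftr2 L) = Y.
  apply/matrixP => i i'; apply: (@ccvg_unique _ _ UU (fun j => Lam (ftr2 (s j)) i i')).
    rewrite linear_entry; under eq_fun do rewrite linear_entry.
    do 2 (apply: ccvg_sum => // ?); apply: ccvgM => //; exact: ccvg_cst.
  by under eq_fun => j do (have [_ _ -> _] := sP j); exact: ccvg_cst.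
have hL : hsnorm (s j) @[j --> U] --> hsnorm L.
  have [+ _] : ccvg U (fun j => \sum_x \sum_y s j x y * (s j x y)^*)
      (\sum_x \sum_y L x y * (L x y)^*).
    do 2 (apply: ccvg_sum => // ?); apply: ccvgM => //; exact: ccvg_conj.
  have nE (f : P -> P -> C) :
      complex.Re (\sum_x \sum_y f x y * (f x y)^*) = hsnorm f.
    rewrite cRe_sum; apply: eq_bigr => x _; rewrite cRe_sum.
    by apply: eq_bigr => y _; rewrite nsqE.
  by rewrite nE; under eq_fun do rewrite nE.
have XL : complex.Re (\tr (X *m ftr2 (s j))) @[j --> U] --> complex.Re (\tr (X *m ftr2 L)).
  have [+ _] : ccvg U (fun j => \tr (X *m ftr2 (s j))) (\tr (X *m ftr2 L)).
    apply: ccvg_sum => // a; rewrite mxE; under eq_fun do rewrite mxE.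
    by apply: ccvg_sum => // b; apply: ccvgM => //; exact: ccvg_cst.
  by [].
have s1 j : hsnorm (s j) <= 1.
  by have [ps t1 _ _] := sP j; have := hsnorm_le ps; rewrite t1 expr1n.
have tX : t <= complex.Re (\tr (X *m ftr2 L)).
  rewrite -(cvg_lim (@norm_hausdorff _ _) XL); apply: limr_ge.
    by apply/cvg_ex; exists (complex.Re (\tr (X *m ftr2 L))).
  apply: filterE => j; have [_ _ _ /ltW] := sP j; rewrite -[t <= _]subr_ge0.
  by apply: le_trans; rewrite mulr_ge0 ?ler0n// subr_ge0.
have h1 : hsnorm L = 1.
  apply/eqP; rewrite eq_le; apply/andP; split.
    by have := hsnorm_le pL; rewrite tL expr1n.
  (* By choice of [s j], adding this quotient to [hsnorm (s j)] gives at least 1. The values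
     converge, so the quotient tends to 0 and the limit inherits the bound. *)
  have c0 : (complex.Re (\tr (X *m ftr2 (s j))) - t) * j.+1%:R^-1 @[j --> U] --> (0 : R).
    rewrite -[X in _ --> X](mulr0 (complex.Re (\tr (X *m ftr2 L)) - t)).
    apply: cvgM; first by apply: cvgB => //; exact: cvg_cst.
    exact: cvg_trans (cvg_app _ oU) (@cvg_harmonic R).
  have cD : hsnorm (s j) + (complex.Re (\tr (X *m ftr2 (s j))) - t) * j.+1%:R^-1
      @[j --> U] --> hsnorm L by rewrite -[X in _ --> X]addr0; exact: cvgD.
  rewrite -(cvg_lim (@norm_hausdorff _ _) cD); apply: limr_ge.
    by apply/cvg_ex; exists (hsnorm L).
  apply: filterE => j /=; have [_ _ _ /ltW] := sP j.
  by rewrite mulrC -ler_pdivlMr ?ltr0n// lerBlDl.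
have := pure_feasible_le_xi pL tL h1 YL; apply/negP; rewrite -ltNge.
by apply: lt_le_trans xt _; rewrite lee_fin.
Qed.

(** The homogeneous form needed for unnormalised conditional states: divide by the trace, or note
    that both sides vanish when it is zero. *)
Lemma purity_gap t : (xi k X Lam Y < t%:E)%E -> exists2 K, 0 <= K &
  forall s : P -> P -> C, fpsd s -> Lam (ftr2 s) = ftr s *: Y ->
    complex.Re (\tr (X *m ftr2 s)) - t * complex.Re (ftr s) <=
      K * (complex.Re (ftr s) - purity s).
Proof.
move=> /purity_gap_normalized[K K0 HK]; exists K => // s ps sY.
have trE : ftr s = real_complex R (complex.Re (ftr s)).
  by have := cIm_ge0 (ftr_ge0 ps); case: (ftr s) => a b /= ->.
set p := complex.Re (ftr s) in trE *.
have : 0 <= p by exact: cRe_le (ftr_ge0 ps).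
rewrite le_eqVlt => /orP[/eqP p0|p0].
  have s0 := ftr_eq0 ps; rewrite trE -p0 in s0.
  have -> : ftr2 s = 0.
    by apply/matrixP => a b; rewrite !mxE big1// => c _; rewrite s0.
  by rewrite /purity -/p -p0 invr0 mulr0 mulmx0 mxtrace0 !mulr0 !subrr mulr0.
pose c : C := real_complex R p^-1.
have cp : c * ftr s = 1 by rewrite trE /c -rmorphM mulVf ?rmorph1// lt0r_neq0.
have sc : ftr2 (fun x y => c * s x y) = c *: ftr2 s.
  by apply/matrixP => a b; rewrite !mxE mulr_sumr.
have := HK (fun x y => c * s x y).
rewrite sc linearZ /= sY scalerA cp scale1r -scalemxAr mxtraceZ.
have c0 : 0 <= c by rewrite ler0c invr_ge0 ltW.
move=> /(_ (fpsd_scale c0 ps)).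
have -> : ftr (fun x y => c * s x y) = 1 by rewrite -cp /ftr mulr_sumr.
have cRe z : complex.Re (c * z) = p^-1 * complex.Re z.
  by rewrite cReM /= mul0r subr0.
have -> : hsnorm (fun x y => c * s x y) = p^-1 ^+ 2 * hsnorm s.
  rewrite /hsnorm mulr_sumr; apply: eq_bigr => x _; rewrite mulr_sumr.
  apply: eq_bigr => y _; rewrite /nsq cRe.
  have -> : complex.Im (c * s x y) = p^-1 * complex.Im (s x y).
    by case: (s x y) => a b /=; rewrite mul0r addr0.
  ring.
move=> /(_ erefl erefl); rewrite cRe -(ler_pM2l p0) => H.
have pn := lt0r_neq0 p0.
have := H; congr (_ <= _); first by rewrite mulrBr mulrA mulfV// mul1r mulrC.
by rewrite /purity -/p; field.
Qed.

End PurityGap.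

(** * Polarization and a tight frame *)

Section Polarization.
Variables (R : realType) (T : finType).
Local Notation C := R[i].

(** The vectors [e_i + u e_j], [u] a fourth root of unity, with [i = j] allowed. The factor [1]
    matches [formDl] and [formDr]. *)
Definition pvec (b : T * T * 'I_4) : T -> C :=
  fun z => 1 * dirac_vec R b.1.1 z + 'i ^+ b.2 * dirac_vec R b.1.2 z.

Lemma form_pvec (g : T -> T -> C) i j (t : 'I_4) (u : C := 'i ^+ t) :
  form g (pvec (i, j, t)) (pvec (i, j, t)) =
  g i i + u * g i j + u^* * g j i + u^* * u * g j j.
Proof. by rewrite /pvec formDl !formDr !form_dirac rmorph1 /= -/u; ring. Qed.

Lemma sum_i4 (F : C -> C) :
  \sum_(t < 4) F ('i ^+ t) = F 1 + F 'i + F (-1) + F (- 'i).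
Proof.
rewrite !big_ord_recl big_ord0 /= /bump /= !addr0 expr0 expr1 !addrA.
have i2 : 'i ^+ (1 + 1) = -1 :> C by exact: sqrCi.
have i3 : 'i ^+ (1 + (1 + 1)) = - 'i :> C by rewrite exprD sqrCi expr1 mulrN1.
by rewrite i2 i3.
Qed.

(** Over the fourth roots of unity, the conjugates and their squares sum to zero, so only the
    [g i j] term survives. *)
Lemma sum_form_pvec_conj (g : T -> T -> C) i j :
  \sum_(t < 4) ('i ^+ t)^* * form g (pvec (i, j, t)) (pvec (i, j, t)) = 4%:R * g i j.
Proof.
under eq_bigr do rewrite form_pvec.
rewrite (sum_i4 (fun u => u^* * (g i i + u * g i j + u^* * g j i + u^* * u * g j j))).
rewrite !rmorphN !rmorph1 /= conjCi; have ii : 'i * 'i = -1 :> C by exact: sqrCi.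
by ring: ii.
Qed.

(** The cross terms cancel over the phases; each pair leaves [4 (g i i + g j j)]. *)
Lemma sum_form_pvec (g : T -> T -> C) :
  \sum_b form g (pvec b) (pvec b) = (8 * #|T|)%:R * ftr g.
Proof.
transitivity (\sum_(ij : T * T) 4%:R * (g ij.1 ij.1 + g ij.2 ij.2)).
  rewrite -(pair_bigA _ (fun ij t => form g (pvec (ij, t)) (pvec (ij, t)))) /=.
  apply: eq_bigr => -[i j] _; under eq_bigr do rewrite form_pvec.
  rewrite (sum_i4 (fun u => g i i + u * g i j + u^* * g j i + u^* * u * g j j)).
  rewrite !rmorphN !rmorph1 /= conjCi; have ii : 'i * 'i = -1 :> C by exact: sqrCi.
  by ring: ii.
rewrite -(pair_bigA _ (fun i j => 4%:R * (g i i + g j j))) /=.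
under eq_bigr => i _ do rewrite -mulr_sumr big_split /= sumr_const.
rewrite -mulr_sumr big_split /= sumr_const sumrMnl -/(ftr g).
by rewrite -[ftr g *+ _]mulr_natl natrM -/#|T|; ring.
Qed.

End Polarization.

(** * Gain of purity in one contraction *)

Section OneStep.
Variables (R : realType) (T I : finType).
Local Notation C := R[i].
(** [rho] models the first marginal and [r b] the marginal after contraction with the frame vector
    [b], built on the basis indices [i b] and [j b]; [u b] is its conjugate phase. *)
Variables (rho : T -> T -> C) (r : I -> T -> T -> C) (u : I -> C) (i j : I -> T).
Variable D : R.
Hypotheses (prho : fpsd rho) (pr : forall b, fpsd (r b)) (u1 : forall b, nsq (u b) = 1).
Hypothesis D0 : 0 < D.
Hypothesis sumr : forall x y, \sum_b r b x y = real_complex R D * rho x y.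
(** Polarization expands the swap of two parties. Up to the factor 4, [swap_r] is its expectation in
    the two-party marginal, equal to the trace by symmetry; [swap_rho] is its expectation in two
    independent copies of [rho], namely [tr (rho^2)]. *)
Hypothesis swap_r : 4%:R * ftr rho = \sum_b u b * r b (j b) (i b).
Hypothesis swap_rho :
  4%:R * (\sum_x \sum_y rho x y * rho y x) = \sum_b u b * (ftr (r b) * rho (j b) (i b)).

Local Notation p := (complex.Re (ftr rho)).

Lemma ftrC (f : T -> T -> C) : fpsd f -> ftr f = real_complex R (complex.Re (ftr f)).
Proof. by move=> pf; have := cIm_ge0 (ftr_ge0 pf); case: (ftr f) => a b /= ->. Qed.

Lemma cReZ (a : R) (z : C) : complex.Re (real_complex R a * z) = a * complex.Re z.
Proof. by rewrite cReM /= mul0r subr0. Qed.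

Lemma cImZ (a : R) (z : C) : complex.Im (real_complex R a * z) = a * complex.Im z.
Proof. by case: z => x y /=; rewrite mul0r addr0. Qed.

(** The real part of the Hilbert-Schmidt inner product. *)
Definition hsdot (f g : T -> T -> C) : R :=
  \sum_x \sum_y (complex.Re (f x y) * complex.Re (g x y)
               + complex.Im (f x y) * complex.Im (g x y)).

Lemma hsnorm_sub (f g : T -> T -> C) (a : R) :
  hsnorm (fun x y => f x y - real_complex R a * g x y) =
  hsnorm f - a * hsdot f g *+ 2 + a ^+ 2 * hsnorm g.
Proof.
rewrite /hsnorm /hsdot !mulr_sumr -!sumrMnl -sumrB -big_split /=.
apply: eq_bigr => x _; rewrite !mulr_sumr -!sumrMnl -sumrB -big_split /=.
apply: eq_bigr => y _; rewrite /nsq !raddfB /= cReZ cImZ; ring.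
Qed.

Lemma sum_hsdot : \sum_b hsdot (r b) rho = D * hsnorm rho.
Proof.
rewrite /hsdot exchange_big /= mulr_sumr; apply: eq_bigr => x _.
rewrite exchange_big /= mulr_sumr; apply: eq_bigr => y _.
rewrite big_split /= -!mulr_suml -cRe_sum -raddf_sum /= sumr.
by rewrite cReZ cImZ /nsq; ring.
Qed.

Lemma sum_ftr : \sum_b complex.Re (ftr (r b)) = D * p.
Proof.
rewrite -cRe_sum /ftr exchange_big /= -cReZ mulr_sumr.
by under eq_bigr do rewrite sumr.
Qed.

Lemma nsq_le_hsnorm (f : T -> T -> C) x y : nsq (f x y) <= hsnorm f.
Proof.
rewrite /hsnorm (bigD1 x) //= (bigD1 y) //= -addrA lerDl addr_ge0 ?sumr_ge0//.
  by move=> z _; exact: nsq_ge0.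
by move=> z _; apply: sumr_ge0 => w _; exact: nsq_ge0.
Qed.

Lemma purity_ge0 (f : T -> T -> C) : fpsd f -> 0 <= purity f.
Proof. by move=> pf; rewrite divr_ge0 ?hsnorm_ge0//; exact: cRe_le (ftr_ge0 pf). Qed.

(* Four times the left-hand side is the sum of [Re (u b * w)] for the increments
   [w = (r b - (p b / p) rho) (j b) (i b)], which are controlled by the increment of
   purity via [Re (u w) <= c p b + |w|^2 / (4 c p b)]. *)
Lemma purity_increment e : 0 < e ->
  p - purity rho <=
  e * p + D ^+ 2 / (64%:R * e) * (D^-1 * (\sum_b purity (r b)) - purity rho).
Proof.
move=> e0; have : 0 <= p by exact: cRe_le (ftr_ge0 prho).
rewrite le_eqVlt => /orP[/eqP p0|p0].
  rewrite /purity -p0 invr0 mulr0 mulr0 subrr add0r subr0.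
  rewrite !mulr_ge0 ?invr_ge0 ?sqr_ge0 ?mulr_ge0 ?(ltW e0) ?(ltW D0)//.
  by apply: sumr_ge0 => b _; exact: purity_ge0.
(* Chosen so that a quarter of [c * (D * p)] is [e * p]; the coefficient [1 / (4 c)] then produces
   [D^2 / (64 e)]. *)
pose c := 4%:R * e / D.
have c0 : 0 < c by rewrite divr_gt0// mulr_gt0.
pose q b := complex.Re (ftr (r b)).
(* Subtract [swap_rho], divided by [p], from [swap_r] and take real parts. *)
have mean : 4%:R * (p - purity rho) =
    \sum_b complex.Re (u b * (r b (j b) (i b) - real_complex R (q b / p) * rho (j b) (i b))).
  have e1 : 4%:R * p = \sum_b complex.Re (u b * r b (j b) (i b)).
    rewrite -cRe_sum -swap_r -[4%:R in RHS](rmorph_nat (real_complex R)) cReZ //.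
  have e2 : 4%:R * hsnorm rho = \sum_b q b * complex.Re (u b * rho (j b) (i b)).
    transitivity (complex.Re (4%:R * (\sum_x \sum_y rho x y * rho y x))).
      rewrite -[4%:R in RHS](rmorph_nat (real_complex R)) cReZ; congr (_ * _).
      rewrite cRe_sum; apply: eq_bigr => x _; rewrite cRe_sum; apply: eq_bigr => y _.
      by case: prho => hr _; rewrite nsqE hr.
    rewrite swap_rho cRe_sum; apply: eq_bigr => b _.
    by rewrite (ftrC (pr b)) mulrCA cReZ.
  rewrite mulrBr e1 /purity mulrA e2 mulr_suml -sumrB; apply: eq_bigr => b _.
  by rewrite mulrBr raddfB /= [in RHS]mulrCA cReZ; congr (_ - _); ring.
have bound b :
    complex.Re (u b * (r b (j b) (i b) - real_complex R (q b / p) * rho (j b) (i b))) <=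
    c * q b + (purity (r b) - hsdot (r b) rho / p *+ 2 + q b * hsnorm rho / p ^+ 2) / (4%:R * c).
  have : 0 <= q b by exact: cRe_le (ftr_ge0 (pr b)).
  rewrite le_eqVlt => /orP[/eqP q0|q0].
    have r0 : forall x y, r b x y = 0 by apply: ftr_eq0 => //; rewrite ftrC// -/(q b) -q0.
    rewrite /purity -/(q b) -q0 r0 !mul0r invr0 !mulr0 subrr mulr0.
    have -> : hsdot (r b) rho = 0.
      by rewrite /hsdot big1// => x _; rewrite big1// => y _; rewrite r0 /= !mul0r addr0.
    by rewrite !mul0r mul0rn subr0 !addr0 mul0r addr0.
  set W := fun x y => r b x y - real_complex R (q b / p) * rho x y.
  have := nsq_le_hsnorm W (j b) (i b); rewrite hsnorm_sub => HW.
  have -> : purity (r b) - hsdot (r b) rho / p *+ 2 + q b * hsnorm rho / p ^+ 2 =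
     (hsnorm (r b) - q b / p * hsdot (r b) rho *+ 2 + (q b / p) ^+ 2 * hsnorm rho) / q b.
    by rewrite /purity -/(q b); field; rewrite !lt0r_neq0.
  set H := (X in X / q b / _).
  have qc0 : 0 < 4%:R * c * q b by rewrite mulr_gt0 // mulr_gt0.
  have -> : c * q b + H / q b / (4%:R * c) = (4%:R * (c * q b) ^+ 2 + H) / (4%:R * c * q b).
    by field; rewrite !lt0r_neq0.
  rewrite ler_pdivlMr//.
  apply: le_trans (_ : _ <= 4%:R * (c * q b) ^+ 2 + nsq (W (j b) (i b))) _; last first.
    by rewrite lerD2l.
  rewrite -/(W (j b) (i b)) cReM; have := u1 b; rewrite /nsq.
  move: (W _ _) (u b) => [w1 w2] [v1 v2] /= v12.
  rewrite -subr_ge0.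
  (* Since [u b] has modulus 1, the difference is the squared modulus of [w - 2 c q v^*]. *)
  have -> : 4%:R * (c * q b) ^+ 2 + (w1 ^+ 2 + w2 ^+ 2) - (v1 * w1 - v2 * w2) * (4%:R * c * q b) =
    (w1 - 2%:R * (c * q b) * v1) ^+ 2 + (w2 + 2%:R * (c * q b) * v2) ^+ 2
    + 4%:R * (c * q b) ^+ 2 * (1 - (v1 ^+ 2 + v2 ^+ 2)) by ring.
  by rewrite v12 subrr mulr0 addr0 addr_ge0 ?sqr_ge0.
(* Summed over [b], the inner products give [-2 D purity rho] and the last terms [D purity rho]. *)
have tot : 4%:R * (p - purity rho) <=
    c * (D * p) + (\sum_b purity (r b) - D * purity rho) / (4%:R * c).
  rewrite mean; apply: le_trans (ler_sum _ (fun b _ => bound b)) _.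
  rewrite big_split /= -mulr_sumr sum_ftr -mulr_suml big_split sumrB /=.
  rewrite sumrMnl -!mulr_suml sum_hsdot sum_ftr /purity.
  rewrite le_eqVlt; apply/predU1P; left; congr (_ + _ / _).
  by field; rewrite lt0r_neq0.
rewrite -(ler_pM2l (_ : 0 < 4%:R :> R))//; apply: le_trans tot _.
rewrite le_eqVlt; apply/predU1P; left.
by rewrite /c; field; rewrite !lt0r_neq0.
Qed.

End OneStep.

(** * The de Finetti bound and convergence of the hierarchy *)

Section DeFinetti.
Variables (R : realType) (n m k : nat).
Local Notation C := R[i].
Local Notation P := ('I_n * 'I_k)%type.
Local Notation op N := ({ffun 'I_N -> P} -> {ffun 'I_N -> P} -> C).
Variables (Lam : {linear 'M[C]_n -> 'M[C]_m}) (Y : 'M[C]_m) (X : 'M[C]_n).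
Local Notation cone := (sdp_cone Lam Y).

Definition marg2 N (f : op N.+2) (s z s' z' : P) : C :=
  \sum_y f (pcons s (pcons z y)) (pcons s' (pcons z' y)).

Lemma marg2_diag N (f : op N.+2) s s' : \sum_z marg2 f s z s' z = marg f s s'.
Proof. by rewrite /marg sum_pcons. Qed.

Lemma marg_contract N v (f : op N.+2) s s' : cone f ->
  marg (contract v f) s s' = form (fun z z' => marg2 f s z s' z') v v.
Proof.
move=> cf; rewrite /marg; under eq_bigr do rewrite (contractE _ _ _ _ _ cf).
rewrite exchange_big /form [RHS]pair_bigA /=; apply: eq_bigr => -[z z'] _ /=.
by rewrite -mulr_sumr -/(marg2 _ _ _ _ _); ring.
Qed.

Lemma ftr_contract N v (f : op N.+1) : ftr (contract v f) = form (marg f) v v.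
Proof.
rewrite /ftr /contract /form exchange_big /=; apply: eq_bigr => z _.
rewrite exchange_big /=; apply: eq_bigr => z' _.
by rewrite /marg mulr_sumr mulr_suml.
Qed.

Local Notation D := ((8 * #|{: P}|)%:R : R).

Lemma sum_marg_contract N (f : op N.+2) s s' : cone f ->
  \sum_b marg (contract (pvec R b) f) s s' = real_complex R D * marg f s s'.
Proof.
move=> cf; under eq_bigr do rewrite (marg_contract _ _ _ cf).
by rewrite sum_form_pvec /ftr marg2_diag rmorph_nat.
Qed.

(** Polarization extracts the entries of [marg2 f] whose row index is the exchanged column index;
    [cone_swapl] makes them diagonal. *)
Lemma contract_swap N (f : op N.+2) : cone f ->
  4%:R * ftr (marg f) =
  \sum_(b : P * P * 'I_4) ('i ^+ b.2)^* * marg (contract (pvec R b) f) b.1.2 b.1.1.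
Proof.
move=> cf; rewrite -(pair_bigA _ (fun (ij : P * P) (t : 'I_4) =>
  ('i ^+ t)^* * marg (contract (pvec R (ij, t)) f) ij.2 ij.1)) /=.
transitivity (\sum_(ij : P * P) 4%:R * marg2 f ij.1 ij.2 ij.1 ij.2).
  rewrite -mulr_sumr -(pair_bigA _ (fun i j => marg2 f i j i j)) /=.
  by congr (_ * _); apply: eq_bigr => s _; rewrite marg2_diag.
apply: eq_bigr => -[i j] _ /=.
under eq_bigr => t _ do rewrite (marg_contract _ _ _ cf).
rewrite sum_form_pvec_conj; congr (_ * _); apply: eq_bigr => y _.
exact: (cone_swapl _ _ _ _ cf).
Qed.

(** The trace of the contraction is the form of [marg f] at the frame vector, so polarization
    recovers the entry [marg f i j]. *)
Lemma contract_purity N (f : op N.+2) :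
  4%:R * (\sum_x \sum_y marg f x y * marg f y x) =
  \sum_(b : P * P * 'I_4) ('i ^+ b.2)^* *
     (ftr (marg (contract (pvec R b) f)) * marg f b.1.2 b.1.1).
Proof.
rewrite -(pair_bigA _ (fun (ij : P * P) (t : 'I_4) =>
  ('i ^+ t)^* * (ftr (marg (contract (pvec R (ij, t)) f)) * marg f ij.2 ij.1))) /=.
rewrite pair_bigA mulr_sumr; apply: eq_bigr => -[i j] _ /=.
rewrite mulrA -sum_form_pvec_conj mulr_suml; apply: eq_bigr => t _.
by rewrite ftr_marg ftr_contract mulrA.
Qed.

Lemma nsq_conj_expi t : nsq ('i ^+ t : C)^* = 1.
Proof.
rewrite nsqE conjCK rmorphXn /= -exprMn conjCi mulNr.
by rewrite -expr2 sqrCi opprK expr1n.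
Qed.

Definition objective N (f : op N.+1) : R := complex.Re (\tr (X *m ftr2 (marg f))).

Lemma sum_objective N (f : op N.+2) : cone f ->
  \sum_b objective (contract (pvec R b) f) = D * objective f.
Proof.
move=> cf; rewrite /objective -cReZ -cRe_sum -mxtraceZ scalemxAr -raddf_sum -mulmx_sumr.
congr (complex.Re (\tr (_ *m _))).
rewrite -ftr2_scale; transitivity (ftr2 (fun s s' =>
    \sum_b 1 * marg (contract (pvec R b) f) s s')).
  by rewrite ftr2_sum; under [RHS]eq_bigr do rewrite scale1r.
congr ftr2; apply/funext => s; apply/funext => s'.
by under eq_bigr do rewrite mul1r; rewrite sum_marg_contract.
Qed.

Hypotheses (n0 : (0 < n)%N) (k0 : (0 < k)%N).

Lemma frame_gt0 : 0 < D.
Proof. by rewrite ltr0n muln_gt0 card_prod !card_ord muln_gt0 n0 k0. Qed.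

(* Contracting one party with the frame [pvec] preserves the cone and averages
   the objective, so the purity increments telescope along the induction. *)
Lemma cone_value_bound t K e : 0 <= K -> 0 < e ->
  (forall s : P -> P -> C, fpsd s -> Lam (ftr2 s) = ftr s *: Y ->
    complex.Re (\tr (X *m ftr2 s)) - t * complex.Re (ftr s) <=
      K * (complex.Re (ftr s) - purity s)) ->
  forall N (f : op N.+1), cone f ->
    N%:R * (objective f - t * complex.Re (ftr f)) <=
    K * (N%:R * e * complex.Re (ftr f)
         + D ^+ 2 / (64%:R * e) * (complex.Re (ftr f) - purity (marg f))).
Proof.
move=> K0 e0 gap; elim=> [|N IH] f cf; have [pf _ _] := cf.
  (* With no contraction left the left side is 0, and purity is at most the trace. *)
  rewrite !mul0r add0r mulr_ge0// mulr_ge0//.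
    by rewrite divr_ge0 ?sqr_ge0// mulr_ge0// ltW.
  by rewrite subr_ge0 -ftr_marg; apply: purity_le; exact: marg_psd.
have D0 := frame_gt0; have pm := marg_psd pf.
pose r b := marg (contract (pvec R b) f).
have pr b : fpsd (r b) by apply: marg_psd; case: (contract_cone (pvec R b) cf).
have sr x y : \sum_b r b x y = real_complex R D * marg f x y by exact: sum_marg_contract.
have step := purity_increment pm pr (fun b => nsq_conj_expi b.2) D0 sr
  (contract_swap cf) (contract_purity f) e0.
have g := gap _ pm (etrans (marg_Lam cf) (congr1 (fun a => a *: Y) (esym (ftr_marg f)))).
rewrite ftr_marg -/(objective f) in g step.
have sp := sum_ftr sr; rewrite ftr_marg in sp.
have := ler_sum (index_enum _) (fun b (_ : true) => IH _ (contract_cone (pvec R b) cf)).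
rewrite -!mulr_sumr sumrB sum_objective// -mulr_sumr.
under eq_bigr do rewrite -ftr_marg -/(r _).
rewrite big_split /= -!mulr_sumr sumrB.
have -> : \sum_b complex.Re (ftr (contract (pvec R b) f)) = D * complex.Re (ftr f).
  by rewrite -sp; apply: eq_bigr => b _; rewrite ftr_marg.
rewrite sp => sumIH.
set p := complex.Re (ftr f) in g step sumIH *; set o := objective f in g sumIH *.
set G := purity (marg f) in g step *; set S := \sum_b purity (r b) in step sumIH.
set kap := D ^+ 2 / (64%:R * e) in step sumIH *.
have {}sumIH : N%:R * (o - t * p) <= K * (N%:R * e * p + kap * (p - D^-1 * S)).
  rewrite -(ler_pM2l D0); move: sumIH; congr (_ <= _); first by ring.
  by rewrite -{1}[S](mulVKf (lt0r_neq0 D0)); ring.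
(* Adding [g], [Kstep] and [sumIH] cancels the mean purity [D^-1 * S]; the extra [K * e * p] turns
   [N] into [N.+1]. *)
have Kstep := ler_wpM2l K0 step.
rewrite -natr1; move: g Kstep sumIH; lra.
Qed.

Lemma xi_hier_le t e : (xi k X Lam Y < t%:E)%E -> 0 < e ->
  exists N, (xi_hier k X Lam Y N <= (t + e)%:E)%E.
Proof.
move=> /purity_gap[K K0 gap] e0.
(* This makes [K * e'] at most [e / 2]; [K + 1] avoids dividing by zero when [K = 0]. *)
pose e' := e / (2%:R * (K + 1)).
have K1 : 0 < K + 1 by rewrite ltr_wpDl.
have e'0 : 0 < e' by rewrite divr_gt0// mulr_gt0.
have bound := cone_value_bound K0 e'0 gap.
set kap := D ^+ 2 / (64%:R * e') in bound.
have kap0 : 0 <= kap by rewrite divr_ge0 ?sqr_ge0// mulr_ge0// ltW.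
(* Large enough for [K * kap / N] to be at most [e / 2], and positive. *)
pose N := (Num.truncn (2%:R * (K * kap) / e)).+1.
have NP : 2%:R * (K * kap) / e < N%:R by exact: truncnS_gt.
have N0 : 0 < N%:R :> R by rewrite ltr0n.
exists N; apply: ge_ereal_sup => _ [Phi /sdp_feasibleE[cP t1] <-].
rewrite lee_fin XA_tr -/(objective (ope Phi)).
have := bound _ _ cP; rewrite t1 /= !mulr1 => H.
have pG0 : 0 <= purity (marg (ope Phi)).
  by apply: purity_ge0; apply: marg_psd; case: cP.
rewrite -lerBlDl -(ler_pM2l N0); apply: le_trans H _.
have h1 : K * (N%:R * e') <= N%:R * (e / 2%:R).
  have -> : N%:R * (e / 2%:R) = (K + 1) * (N%:R * e') by rewrite /e'; field; rewrite lt0r_neq0.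
  by rewrite ler_wpM2r ?lerDl// mulr_ge0 ?ler0n// ltW.
have h2 : K * kap <= N%:R * (e / 2%:R).
  move: NP; rewrite ltr_pdivrMr// => /ltW NP.
  rewrite -(ler_pM2l (_ : 0 < 2%:R :> R))//; apply: le_trans NP _.
  by rewrite le_eqVlt; apply/predU1P; left; field.
have h3 : K * (kap * (1 - purity (marg (ope Phi)))) <= K * kap.
  by rewrite ler_wpM2l// ler_piMr// lerBlDr lerDl.
rewrite mulrDr; apply: le_trans (lerD h1 (le_trans h3 h2)) _.
by rewrite le_eqVlt; apply/predU1P; left; field.
Qed.

Lemma ereal_inf_xi_hier :
  (ereal_inf (range (xi_hier k X Lam Y)) <= xi k X Lam Y)%E.
Proof.
have le_t t : (xi k X Lam Y < t%:E)%E -> (ereal_inf (range (xi_hier k X Lam Y)) <= t%:E)%E.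
  move=> xt; apply/lee_addgt0Pr => e e0.
  have [N NP] := xi_hier_le xt e0; rewrite -EFinD; apply: le_trans NP.
  by apply: ereal_inf_lbound; exists N.
move: le_t; case: (xi k X Lam Y) => [x||] le_t; last 2 first.
- exact: leey.
(* When [xi] is [-oo], every real bounds the infimum from above, so the infimum is neither real nor
   [+oo]. *)
- move: le_t; case: (ereal_inf _) => [y||] le_t //.
    by have := le_t (y - 1) (ltNyr _); rewrite lee_fin => ?; exfalso; lra.
  by have := le_t 0 (ltNyr _).
by apply/lee_addgt0Pr => e e0; rewrite -EFinD; apply: le_t; rewrite lte_fin ltrDl.
Qed.

End DeFinetti.

(* xi_hier ... N is the SDP value xi_{N+1} with N+1 parties A,B,...,Z. *)
Theorem theorem2 (R : realType) (n m k : nat)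
  (X : 'M[R[i]]_n) (Lam : {linear 'M[R[i]]_n -> 'M[R[i]]_m}) (Y : 'M[R[i]]_m) :
  (0 < n)%N -> (0 < m)%N -> (0 < k)%N -> herm X ->
  [/\ (forall N : nat, (xi k X Lam Y <= xi_hier k X Lam Y N)%E),
      (forall N : nat, (xi_hier k X Lam Y N.+1 <= xi_hier k X Lam Y N)%E)
    & (xi_hier k X Lam Y N @[N --> \oo] --> xi k X Lam Y)].
Proof.
move=> n0 _ k0 _; have decr N := xi_hier_decr k Lam Y X N.
split=> //; first exact: xi_le_xi_hier.
have -> : xi k X Lam Y = ereal_inf (range (xi_hier k X Lam Y)).
  apply/eqP; rewrite eq_le ereal_inf_xi_hier// andbT.
  by apply: le_ereal_inf_tmp => _ [N _ <-]; exact: xi_le_xi_hier.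
by apply: ereal_nonincreasing_cvgn; exact/nonincreasing_seqP.
Qed.
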